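(* Let $k\ge 2$, let $r_{ij}=r_{ji}$ ($1\le i\neq j\le k$) be positive integers, let $\Pi=\Pi(r_{12},\dots,r_{k-1\,k})$ be the Gale dual type-A root polytope, and let $\hat d=\sum_{1\le i<j\le k} r_{ij}-k+1$. Then $$g(\Pi,t+1)=\hat g_0+t\hat g_1+t^2\hat g_2+\dots+t^{\hat d}\hat g_{\hat d},$$ where $\hat g_i$ is the number of acyclic subgraphs $G\subset\mathbb{G}_k$ with $k$ vertices and $k-1+i$ edges which are rooted at the first vertex.
   Context: **Polytope.** For $1\le i\ne j\le k$ let $\alpha_{ij}=\varepsilon_i-\varepsilon_j$ in $\mathfrak a_k^*=\{x\in\mathbb R^k: x_1+\dots+x_k=0\}$. Let $\mathfrak A=\mathfrak A(r_{12},\dots,r_{k-1\,k})$ be the sequence in which each $\alpha_{ij}$ (for every ordered pair $i\neq j$) is repeated $r_{ij}$ times; $n=|\mathfrak A|=2\sum_{i<j}r_{ij}$, $d=n-k+1$. Write $\mathfrak A=[\alpha_1,\dots,\alpha_n]$. Let $\mathfrak t$ be the dual of the $d$-dimensional space $\mathfrak t^*=\{m\in\mathbb R^n:\sum_i m_i\alpha_i=0\}$, and let $\beta_i\in\mathfrak t$ be the functional $m\mapsto m_i$ (the Gale dual sequence $\mathfrak B=[\beta_1,\dots,\beta_n]$). $\Pi$ is the convex hull of $\beta_1,\dots,\beta_n$; it is a polytope of dimension $d-1$ lying in an affine hyperplane that does not contain the origin. **Graphs.** $\mathbb K_k$ is the directed multigraph on vertices $\{1,\dots,k\}$ with exactly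 $r_{ij}$ (distinguishable) edges from $i$ to $j$ for every ordered pair $i\ne j$. $\mathbb G_k$ is obtained from $\mathbb K_k$ by deleting all edges going out of vertex $1$. A subgraph with $k$ vertices is the full vertex set together with a subset of the edges. A directed graph is acyclic if it has no directed cycle; it is rooted at vertex $v$ if there is a directed path from every vertex to $v$. **$g$- and $h$-polynomials (Stanley).** For convex polytopes define inductively: $g(\emptyset,t)=h(\emptyset,t)=1$, $\dim\emptyset=-1$; for a polytope $P$ of dimension $D\ge 0$, $$h(P,t)=\sum_{F<P}g(F,t)(t-1)^{D-1-\dim F},$$ the sum over all proper faces $F$ of $P$ including the empty face; writing $h(P,t)=\sum_{i=0}^D h_it^i$, set $g(P,t)=h_0+\sum_{i=1}^{\lfloor D/2\rfloor}(h_i-h_{i-1})t^i$. *)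

(* Defs.v *)
From HB Require Import structures.
From mathcomp Require Import all_boot all_order all_algebra.
From mathcomp Require Import boolp classical_sets cardinality fsbigop reals.

Set Implicit Arguments.
Unset Strict Implicit.
Unset Printing Implicit Defensive.

Import Order.TTheory GRing.Theory Num.Theory.
Local Open Scope classical_set_scope.
Local Open Scope ring_scope.

Section Polytopes.
Variables (R : realType) (V : vectType R).

Definition conv (I : finType) (p : I -> V) : set V :=
  [set x | exists w : I -> R,
     [/\ forall i, 0 <= w i, \sum_i w i = 1 & x = \sum_i w i *: p i]].

(* Exposed faces; [set0] and [P] itself are faces, take [l = 0] and
   [c = 1] or [c = 0]. *)
Definition is_face (P F : set V) : Prop :=
  exists (l : 'Hom(V, R^o)) (c : R),
    (forall x, P x -> l x <= c) /\ F = [set x | P x /\ l x = c].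

Definition proper_faces (P : set V) : set (set V) :=
  [set F | is_face P F /\ F <> P].

Definition affine_free (m : nat) (x : 'I_m -> V) : Prop :=
  forall c : 'I_m -> R,
    \sum_i c i *: x i = 0 -> \sum_i c i = 0 -> forall i, c i = 0.

(* [dim1 S] is the dimension of [S] plus one, so that [dim1 set0 = 0] encodes
   the convention that the empty polytope has dimension -1: it is the largest
   number of affinely independent points of [S]. The bound on [m] is harmless,
   see [affine_free_leq]. *)
Definition dim1 (S : set V) : nat :=
  \max_(m < (\dim {:V}).+2
        | `[< exists x : 'I_m -> V, (forall i, S (x i)) /\ affine_free x >]) m.

(* With [D = dim P] and [e = dim F], [(dim1 P - dim1 F).-1 = D - 1 - e]. *)
Definition h_of_g (g : set V -> {poly int}) (P : set V) : {poly int} :=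
  \sum_(F \in proper_faces P) g F * ('X - 1) ^+ (dim1 P - dim1 F).-1.

Definition g_of_h (D : nat) (h : {poly int}) : {poly int} :=
  \poly_(i < D./2.+1) (if i is j.+1 then h`_j.+1 - h`_j else h`_0).

(* The first argument is fuel for the recursion on the dimension; lemmas
   [gpolyE] and [hpolyE] are the recursive definition proper. *)
Fixpoint gpoly_rec (n : nat) (P : set V) : {poly int} :=
  if n is m.+1 then
    if `[< P = set0 >] then 1
    else g_of_h (dim1 P).-1 (h_of_g (gpoly_rec m) P)
  else 1.

Definition gpoly (P : set V) : {poly int} := gpoly_rec (dim1 P) P.

Definition hpoly (P : set V) : {poly int} :=
  if `[< P = set0 >] then 1 else h_of_g gpoly P.

Lemma affine_free_leq m (x : 'I_m -> V) :
  affine_free x -> (m <= (\dim {:V}).+1)%N.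
Proof.
case: m x => // m x xfree; rewrite ltnS.
pose y := [tuple x (lift ord0 i) - x ord0 | i < m].
have /eqP <- : size y == m by rewrite size_tuple.
suff yfree : free y by rewrite -(eqP yfree) dimvS ?subvf.
apply/freeP => k yk0 i.
pose c j := if unlift ord0 j is Some l then k l else - \sum_l k l.
have cl l : c (lift ord0 l) = k l by rewrite /c liftK.
have c0 : c ord0 = - \sum_l k l by rewrite /c unlift_none.
rewrite -cl; apply: xfree; rewrite big_ord_recl.
  under eq_bigr do rewrite cl.
  rewrite c0 -[RHS]yk0 scaleNr scaler_suml addrC -sumrB; apply: eq_bigr => j _.
  by rewrite (nth_map j) ?size_enum_ord// nth_ord_enum scalerBr.
by under eq_bigr do rewrite cl; rewrite c0 addNr.
Qed.

Lemma affine_free_dim1 (S : set V) m (x : 'I_m -> V) :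
  (forall i, S (x i)) -> affine_free x -> (m <= dim1 S)%N.
Proof.
move=> Sx xfree.
have ltm : (m < (\dim {:V}).+2)%N by rewrite ltnS (affine_free_leq xfree).
rewrite /dim1 (bigD1 (Ordinal ltm)) ?leq_maxl//.
by apply/asboolP; exists x.
Qed.

Lemma dim1_witness (S : set V) :
  exists x : 'I_(dim1 S) -> V, (forall i, S (x i)) /\ affine_free x.
Proof.
rewrite /dim1; elim/big_ind: _ => [|m n Hm Hn|i /asboolP//].
- by exists (fun=> 0); split=> [|c _ _]; case.
- by rewrite /maxn; case: ifP.
Qed.

Lemma dim1_set0 : dim1 set0 = 0%N.
Proof.
have [x [x0 _]] := dim1_witness set0.
by case: (dim1 set0) x x0 => // m x /(_ ord0).
Qed.

Lemma dim1_eq0 (S : set V) : dim1 S = 0%N -> S = set0.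
Proof.
move=> S0; rewrite -subset0 => x Sx.
suff: (1 <= dim1 S)%N by rewrite S0.
apply: (@affine_free_dim1 S 1 (fun=> x)) => // c _ + i.
by rewrite big_ord1 (ord1 i).
Qed.

Lemma dim1_proper_face (P F : set V) :
  proper_faces P F -> (dim1 F < dim1 P)%N.
Proof.
move=> [[l [c [_ ->]]] FP]; set F' := [set x | _].
have [p Pp lp] : exists2 p, P p & l p <> c.
  apply: contrapT => /forall2NP H; apply: FP; rewrite seteqP; split=> x //=.
    by case.
  by move=> Px; split=> //; have [//|/contrapT] := H x.
have [x [Fx xfree]] := dim1_witness F'.
move: (dim1 F') x Fx xfree => m x Fx xfree.
pose y i := if unlift ord0 i is Some j then x j else p.
apply: (@affine_free_dim1 P _ y).
  by move=> i; rewrite /y; case: unliftP => // j _; have [] := Fx j.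
move=> k; rewrite !big_ord_recl /y unlift_none => ky0 k0.
have ky0' : k ord0 *: p + \sum_i k (lift ord0 i) *: x i = 0.
  by rewrite -[RHS]ky0; congr (_ + _); apply: eq_bigr => i _; rewrite liftK.
have k00 : k ord0 = 0.
  have := congr1 l ky0'.
  have -> : l (k ord0 *: p + \sum_i k (lift ord0 i) *: x i)
      = k ord0 * l p + (\sum_i k (lift ord0 i)) * c.
    rewrite linearD linearZ linear_sum mulr_suml; congr (_ + _).
    by apply: eq_bigr => i _; rewrite linearZ /= (Fx i).2.
  rewrite linear0.
  rewrite -[X in _ + X * _](addKr (k ord0)) k0 addr0 mulNr.
  rewrite -mulrBr => /eqP; rewrite mulf_eq0 => /orP[/eqP//|].
  by rewrite subr_eq0 => /eqP.
move: ky0' k0; rewrite k00 scale0r !add0r => kx0 ks i.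
have [j ->|->//] := unliftP ord0 i.
exact: (xfree (fun j => k (lift ord0 j))).
Qed.

Lemma gpoly_recE n (P : set V) : (dim1 P <= n)%N -> gpoly_rec n P = gpoly P.
Proof.
rewrite /gpoly; have [m] := ubnP (dim1 P).
elim: m => // m IHm in n P *; rewrite ltnS => Pm.
case: n => [|n] Pn; first by move: Pn; rewrite leqn0 => /eqP ->.
case PE : (dim1 P) => [|q] /=; first by rewrite asboolT// (dim1_eq0 PE).
case: ifP => // _; congr g_of_h; apply: eq_fsbigr => F.
rewrite inE => /dim1_proper_face; rewrite PE ltnS => Fq.
rewrite PE in Pm Pn.
have Fm : (dim1 F < m)%N by rewrite (leq_ltn_trans Fq).
by rewrite !IHm// (leq_trans Fq).
Qed.

Lemma gpoly0 : gpoly set0 = 1.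
Proof. by rewrite /gpoly dim1_set0. Qed.

Lemma gpolyE (P : set V) :
  P <> set0 -> gpoly P = g_of_h (dim1 P).-1 (hpoly P).
Proof.
move=> P0; rewrite /hpoly asboolF//.
rewrite /gpoly; case PE: (dim1 P) => [|q]; first by have := dim1_eq0 PE.
rewrite /= asboolF// PE; congr g_of_h; apply: eq_fsbigr => F.
by rewrite inE => /dim1_proper_face; rewrite PE ltnS => /gpoly_recE ->.
Qed.

Lemma hpoly0 : hpoly set0 = 1.
Proof. by rewrite /hpoly asboolT. Qed.

Lemma hpolyE (P : set V) :
  P <> set0 ->
  hpoly P =
    \sum_(F \in proper_faces P) gpoly F * ('X - 1) ^+ (dim1 P - dim1 F).-1.
Proof. by move=> P0; rewrite /hpoly asboolF. Qed.

(* [\sum_(F \in A) _] is only meaningful when its support is finite. *)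
Lemma finite_proper_faces (I : finType) (p : I -> V) :
  finite_set (proper_faces (conv p)).
Proof.
pose D (l : 'Hom(V, R^o)) c := [set i | l (p i) == c]%SET.
pose hull (A : {set I}) : set V := [set x | exists w : I -> R,
  [/\ forall i, 0 <= w i, \sum_i w i = 1, forall i, i \notin A -> w i = 0
    & x = \sum_i w i *: p i]].
apply: (@sub_finite_set _ _ (hull @` [set: {set I}]%classic)); last first.
  exact: finite_image.
move=> _ [[l [c [lc ->]]] _]; exists (D l c) => //.
have lpc i : l (p i) <= c.
  apply: lc; exists (fun j => (j == i)%:R); split.
  - by move=> j; rewrite ler0n.
  - by rewrite (bigD1 i)//= eqxx big1 ?addr0// => j /negbTE ->.
  - rewrite (bigD1 i)//= eqxx scale1r big1 ?addr0// => j /negbTE ->.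
    by rewrite scale0r.
rewrite seteqP; split=> [x [w [w0 w1 wD ->]]|x [[w [w0 w1 ->]] lx]] /=.
  split; first by exists w.
  rewrite linear_sum -[RHS]mul1r -w1 mulr_suml; apply: eq_bigr => i _ /=.
  rewrite linearZ /=; have [|iD] := boolP (i \in D l c).
    by rewrite inE => /eqP ->.
  by rewrite (wD _ iD) scale0r mul0r.
exists w; split=> // i; rewrite inE => lpi; apply/eqP.
have : \sum_i w i * (c - l (p i)) == 0.
  under eq_bigr do rewrite mulrBr.
  rewrite sumrB -mulr_suml w1 mul1r -lx linear_sum subr_eq0; apply/eqP.
  by apply: eq_bigr => j _; rewrite linearZ.
rewrite psumr_eq0; last by move=> j _; rewrite mulr_ge0 ?subr_ge0.
move=> /allP/(_ i (mem_index_enum _))/=.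
by rewrite mulf_eq0 subr_eq0 [c == _]eq_sym (negbTE lpi) orbF.
Qed.

End Polytopes.

Section RootPolytope.
Variables (R : realType) (k : nat) (r : 'I_k -> 'I_k -> nat).

(* The edges of the multigraph K_k, which also index the sequence of roots:
   the dependent pair [((i, j), l)] with [i != j] and [l < r i j] is the
   [l]-th edge from [i] to [j], or the [l]-th copy of the root
   [e_i - e_j]. *)
Definition edge : finType :=
  {ij : 'I_k * 'I_k & 'I_(if ij.1 == ij.2 then 0 else r ij.1 ij.2)%N}.

Definition src (e : edge) : 'I_k := (tag e).1.
Definition tgt (e : edge) : 'I_k := (tag e).2.

Definition alpha (e : edge) : 'rV[R]_k :=
  delta_mx 0 (src e) - delta_mx 0 (tgt e).

Definition rel_map (m : {ffun edge -> R^o}) : 'rV[R]_k :=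
  \sum_e m e *: alpha e.

Lemma rel_map_is_linear : linear rel_map.
Proof.
move=> a m m'; rewrite /rel_map scaler_sumr -big_split; apply: eq_bigr => e _.
by rewrite !ffunE scalerDl scalerA.
Qed.
HB.instance Definition _ :=
  GRing.isLinear.Build R {ffun edge -> R^o} 'rV[R]_k _ rel_map
    rel_map_is_linear.

Definition relations : {vspace {ffun edge -> R^o}} := lker (linfun rel_map).

Lemma mem_relations m : (m \in relations) = (\sum_e m e *: alpha e == 0).
Proof. by rewrite memv_ker lfunE. Qed.

Definition gale_space := 'Hom(subvs_of relations, R^o).

Definition coord_at (e : edge) (m : subvs_of relations) : R^o := vsval m e.

Lemma coord_at_is_linear e : linear (coord_at e).
Proof. by move=> a m m'; rewrite /coord_at linearP /= !ffunE. Qed.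
HB.instance Definition _ e :=
  GRing.isLinear.Build R (subvs_of relations) R^o _ (coord_at e)
    (coord_at_is_linear e).

Definition beta (e : edge) : gale_space := linfun (coord_at e).

Lemma betaE e (m : subvs_of relations) : beta e m = vsval m e.
Proof. by rewrite lfunE. Qed.

Definition root_polytope : set gale_space := conv beta.

End RootPolytope.

Arguments root_polytope R {k} r _.

Section Graphs.
Variables (k : nat) (r : 'I_k -> 'I_k -> nat).

(* A subgraph of K_k on the full vertex set is a set of edges. *)
Implicit Type G : {set edge r}.

Definition arc G : rel 'I_k :=
  [rel u v | [exists e in G, (src e == u) && (tgt e == v)]].

Definition acyclic G : Prop := forall c : seq 'I_k, ucycle (arc G) c -> c = [::].

Definition rooted_at (v : 'I_k) G : Prop := forall u, connect (arc G) u v.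

(* The edge set of the graph obtained from K_k by deleting the edges going
   out of [v]. *)
Definition edges_not_from (v : 'I_k) : {set edge r} :=
  [set e | src e != v]%SET.

Definition num_rooted_acyclic (v : 'I_k) (m : nat) : nat :=
  #|[set G : {set edge r} | `[< [/\ G \subset edges_not_from v, acyclic G,
                                    rooted_at v G & #|G| = m] >]]%SET|.

End Graphs.

(* Main.v *)
(* Adding multiples of the all-ones relation, the faces of the Gale dual
   polytope correspond to the supports [C] of nonnegative circulations of K_k,
   that is to the totally cyclic edge sets: the face of [C] is the hull of the
   [beta e] with [e] not in [C]. Its dimension plus one is
   #|~: C| + 1 - (number of components of [C]).
     Its g-polynomial is the generating function in [t - 1] of the rooted
   acyclic subgraphs of the contraction K_k / C, encoded here as the rooted
   subgraphs [S] whose cyclic edges (the edges lying on a directed cycle of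
   [S]) are exactly those of [C]. Summing these generating functions over the
   faces of a face, every rooted [S] containing [C] occurs exactly once, since
   [S] determines its set of cyclic edges; on the other hand the indicator of
   [S] being rooted is the signed sum, over the acyclic rooted [H], of the
   indicators of [S] containing [H]. This yields the functional equation
   t^(dim F + 1) g(F, 1/t) = sum_(F' <= F) g(F', t) (t - 1)^(dim F - dim F'),
   and, with the degree bound given by reversing edges, it characterizes the
   g-polynomials. *)
Require Import Defs.
From HB Require Import structures.
From mathcomp Require Import all_boot all_order all_algebra.
From mathcomp Require Import zify lra.
From mathcomp Require Import boolp classical_sets fsbigop reals.
(* [set0], [subsetP], etc. are those of fintype and finset, not those of
   classical_sets, and [arc] is the one of Defs, not the one of path. *)
Import fintype mathcomp.boot.finset Defs.

Set Implicit Arguments.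
Unset Strict Implicit.
Unset Printing Implicit Defensive.

Import Order.TTheory GRing.Theory Num.Theory.
Local Open Scope ring_scope.

(** * Edges on directed cycles *)

Section Core.
Variables (k : nat) (r : 'I_k -> 'I_k -> nat).
Implicit Types (C G H S : {set edge r}) (A : {set 'I_k}) (e x : edge r).
Implicit Types (u v w : 'I_k).

Lemma arcP G u v :
  reflect (exists2 e, e \in G & src e = u /\ tgt e = v) (arc G u v).
Proof.
apply: (iffP existsP) => [[e /and3P[eG /eqP su /eqP tv]]|[e eG [su tv]]].
  by exists e.
by exists e; rewrite eG su tv !eqxx.
Qed.

Lemma arc_edge G e : e \in G -> arc G (src e) (tgt e).
Proof. by move=> eG; apply/arcP; exists e. Qed.

Lemma connect_edge G e : e \in G -> connect (arc G) (src e) (tgt e).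
Proof. by move/arc_edge/connect1. Qed.

Lemma connect_arcS G H u v :
  G \subset H -> connect (arc G) u v -> connect (arc H) u v.
Proof.
move=> /subsetP GH; apply: connect_sub => {u v} u v /arcP[e eG [<- <-]].
exact/connect_edge/GH.
Qed.

Lemma connect_arc_ind G v (P : 'I_k -> Prop) :
  P v ->
  (forall e, e \in G -> connect (arc G) (tgt e) v -> P (tgt e) -> P (src e)) ->
  forall u, connect (arc G) u v -> P u.
Proof.
move=> Pv Pe u /connectP[p pP vE]; subst v.
elim: p u pP Pv Pe => [//|w p IHp] u /= /andP[/arcP[e eG [<- <-]] pP] Pv Pe.
by apply: (Pe e eG); [apply/connectP; exists p|apply: IHp].
Qed.

Lemma connect_arc_closed G (P : pred 'I_k) u v :
  {in G, forall e, P (src e) -> P (tgt e)} ->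
  connect (arc G) u v -> P u -> P v.
Proof.
move=> GP; move: u; apply: connect_arc_ind => // e eG _ Pv /(GP _ eG).
exact: Pv.
Qed.

Lemma connect_arc_crossing G (P : pred 'I_k) u v :
  connect (arc G) u v -> P u -> ~~ P v ->
  exists2 e, e \in G & P (src e) && ~~ P (tgt e).
Proof.
move=> uv Pu Pv; apply/exists_inP; apply: contraNT Pv => /exists_inPn nG.
apply: connect_arc_closed uv Pu => e eG Ps.
by have := nG e eG; rewrite Ps negbK.
Qed.

(** These are the edges inside the strong components of [G]. *)
Definition core G := [set e in G | connect (arc G) (tgt e) (src e)].

Definition totally_cyclic C := core C == C.

Definition rooted v G := [forall u, connect (arc G) u v].

(* For totally cyclic [C], [arc C] has a symmetric reachability relation, and
   this is its number of classes. *)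
Definition ncomp C := #|[set u | roots (arc C) u]|.

Lemma in_core G e :
  (e \in core G) = (e \in G) && connect (arc G) (tgt e) (src e).
Proof. by rewrite inE. Qed.

Lemma core_sub G : core G \subset G.
Proof. by apply/subsetP => e; rewrite in_core => /andP[]. Qed.

Lemma coreS G H : G \subset H -> core G \subset core H.
Proof.
move=> GH; apply/subsetP => e; rewrite !in_core => /andP[eG ce].
by rewrite (subsetP GH)// (connect_arcS GH).
Qed.

(** The return path closes up every edge of the walk from [u] to [v] into a directed cycle, so the
    walk stays in the core. *)
Lemma connect_core G u v :
  connect (arc G) u v -> connect (arc G) v u -> connect (arc (core G)) u v.
Proof.
move: u; apply: connect_arc_ind => [//|e eG tv IH vs].
have eC : e \in core G by rewrite in_core eG (connect_trans tv).
apply: connect_trans (connect_edge eC) (IH _).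
exact: connect_trans vs (connect_edge eG).
Qed.

Lemma core_totally_cyclic G : totally_cyclic (core G).
Proof.
rewrite /totally_cyclic eqEsubset core_sub; apply/subsetP => e eC.
rewrite in_core eC; move: eC; rewrite in_core => /andP[eG ts].
exact: connect_core (connect_edge eG).
Qed.

Lemma subset_core C S :
  totally_cyclic C -> (C \subset core S) = (C \subset S).
Proof.
move=> /eqP tC; apply/idP/idP => [CS|/coreS]; last by rewrite tC.
exact: subset_trans (core_sub S).
Qed.

Lemma totally_cyclic_sym C : totally_cyclic C -> connect_sym (arc C).
Proof.
move=> /eqP tC.
suff sym u v : connect (arc C) u v -> connect (arc C) v u.
  by move=> u v; apply/idP/idP; apply: sym.
move: u; apply: connect_arc_ind => // e eC _ vt.
by apply: connect_trans vt _; move: eC; rewrite -{1}tC in_core => /andP[].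
Qed.

Lemma ncomp_set0 : ncomp (set0 : {set edge r}) = k.
Proof.
have con0 u v : connect (arc (set0 : {set edge r})) u v -> u = v.
  by move: u; apply: connect_arc_ind => // e; rewrite inE.
rewrite /ncomp (_ : [set u | _] = setT) ?cardsT ?card_ord//.
apply/setP => u; rewrite !inE; apply/eqP.
by rewrite -(con0 _ _ (connect_root _ u)).
Qed.

Lemma rootedP v G : reflect (rooted_at v G) (rooted v G).
Proof. exact: forallP. Qed.

Lemma rootedS v G H : G \subset H -> rooted v G -> rooted v H.
Proof.
by move=> GH /forallP vG; apply/forallP => u; apply: connect_arcS (vG u).
Qed.

Lemma acyclicP G : reflect (acyclic G) (core G == set0).
Proof.
apply: (iffP eqP) => [G0 [//|u p] /andP[cG _]|aG].
  have : arc G u (next (u :: p) u) by apply: (next_cycle cG); rewrite mem_head.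
  have cu : connect (arc G) (next (u :: p) u) u.
    by apply: (connect_cycle cG); rewrite ?mem_next mem_head.
  move=> /arcP[e eG [su tu]].
  by have := in_set0 e; rewrite -G0 in_core eG su tu cu.
apply/eqP; rewrite -subset0; apply/subsetP => e.
rewrite in_core => /andP[eG /connectP[p pP sE]].
case/shortenP: pP sE => p' pP' uP _ sE'.
suff : ucycle (arc G) (tgt e :: p') by move/aG.
by rewrite /ucycle uP andbT /= rcons_path pP' -sE' arc_edge.
Qed.

Definition cell C u := [set w | connect (arc C) u w].

(** For totally cyclic [C] equal to [core H], these edges lead out of the component of [u]: they are
    its out-edges in the quotient. *)
Definition exits C H u := [set x in H :\: C | connect (arc C) u (src x)].

(* These are the [H] between [C] and [S] whose quotient by the strong
   components of [C] is acyclic and has [A] as its set of sinks. *)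
Definition admissible C S A H :=
  [&& H \subset S, core H == C, [forall x in H :\: C, src x \notin A]
    & [forall (u | u \notin A), exits C H u != set0]].

Lemma admissibleP C S A H :
  reflect [/\ H \subset S, core H = C, {in H :\: C, forall x, src x \notin A}
            & forall u, u \notin A -> exists x, x \in exits C H u]
          (admissible C S A H).
Proof.
apply: (iffP and4P) => [[HS /eqP HC /forall_inP HA /forall_inP HE]|].
  by split=> // u /HE /set0Pn.
case=> HS HC HA HE; split=> //; first exact/eqP.
  exact/forall_inP.
by apply/forall_inP => u /HE /set0Pn.
Qed.

(** * Adding and deleting an edge that enters a union of components *)

Section Toggle.
Variables (C S : {set edge r}) (A : {set 'I_k}) (e : edge r).
Hypothesis tC : totally_cyclic C.
Hypothesis closedA : forall u w, connect (arc C) u w -> (u \in A) = (w \in A).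
Hypotheses (eS : e \in S) (se : src e \notin A) (te : tgt e \in A).

Let eNC : e \notin C.
Proof.
by apply: contra se => eC; rewrite (closedA (connect_edge eC)).
Qed.

(** Walks of [e |: H] never leave [A], so no cycle passes through the entering edge [e]. *)
Lemma core_setU1 H :
  core H = C -> {in H :\: C, forall x, src x \notin A} -> core (e |: H) = C.
Proof.
move=> HC HA; apply/eqP; rewrite eqEsubset -{2}HC (coreS (subsetU1 e H)) andbT.
have stayA u w : connect (arc (e |: H)) u w -> u \in A -> w \in A.
  apply: (connect_arc_closed (P := mem A)) => /= x /setU1P[->|xH].
    by rewrite (negPf se).
  have [xC|xC] := boolP (x \in C).
    by rewrite (closedA (connect_edge xC)).
  by rewrite (negPf (HA x _))// inE xC.
have con u w : w \notin A -> connect (arc (e |: H)) u w -> connect (arc H) u w.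
  move=> wA; move: u; apply: connect_arc_ind => // x /setU1P[->|xH] cx IH.
    by rewrite (stayA _ _ cx te) in wA.
  exact: connect_trans (connect_edge xH) IH.
apply/subsetP => x; rewrite in_core => /andP[/setU1P[->|xH] cx].
  by have := se; rewrite (stayA _ _ cx te).
have /orP[//|xC] := orbN (x \in C).
by rewrite -HC in_core xH con// HA// inE xC.
Qed.

Lemma admissible_add H : admissible C S A H -> admissible C S A (e |: H).
Proof.
case/admissibleP => HS HC HA HE; apply/admissibleP; split.
- by rewrite subUset sub1set eS.
- exact: core_setU1.
- by move=> x; rewrite !inE => /andP[xC /orP[/eqP->//|xH]]; rewrite HA// inE xC.
- move=> u /HE[x]; rewrite !inE => /andP[/andP[xC xH] cx]; exists x.
  by rewrite !inE xC xH cx orbT.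
Qed.

Lemma core_setD1 H : core H = C -> core (H :\ e) = C.
Proof.
move=> HC; apply/eqP; rewrite eqEsubset -{1}HC (coreS (subD1set H e)) /=.
by rewrite (subset_core _ tC) subsetD1 eNC -HC core_sub.
Qed.

(** Deletion can only fail by leaving the component of [src e] without an out-edge. *)
Lemma admissible_remove H : admissible C S A H ->
  exits C H (src e) != [set e] -> admissible C S A (H :\ e).
Proof.
case/admissibleP => HS HC HA HE He; apply/admissibleP; split.
- exact: subset_trans (subD1set H e) HS.
- exact: core_setD1.
- by move=> x; rewrite !inE => /and3P[xC _ xH]; rewrite HA// inE xC.
- move=> u uA; have [ue|ue] := boolP (connect (arc C) u (src e)).
    have [x xHe xe] : exists2 x, x \in exits C H (src e) & x != e.
      apply/exists_inP; apply: contraNT He => /exists_inPn He.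
      have [x xHe] := HE _ se.
      rewrite eqEsubset; apply/andP; split.
        by apply/subsetP => y /He; rewrite negbK inE.
      by have := He x xHe; rewrite negbK sub1set => /eqP {1}<-.
    exists x; move: xHe; rewrite !inE xe => /andP[/andP[-> ->]] /=.
    exact: connect_trans ue.
  have [x] := HE _ uA; rewrite !inE => /andP[/andP[xC xH] cx]; exists x.
  rewrite !inE xC xH cx !andbT.
  by apply: contraNneq ue => <-.
Qed.

(** If [e] is the only way out of the component of [src e], deleting it turns that component into a
    sink, which is absorbed into [A]. *)
Lemma admissible_merge H :
  admissible C S A (e |: H) && (exits C (e |: H) (src e) == [set e])
    && ((e |: H) :\ e == H)
  = admissible C S (A :|: cell C (src e)) H.
Proof.
have symC := totally_cyclic_sym tC.
apply/idP/idP.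
  case/andP=> /andP[/admissibleP[HS HC HA HE] /eqP ex] /eqP HeH.
  have eNH : e \notin H by rewrite -HeH !inE eqxx.
  have inH x : x \in H -> x != e by apply: contraTneq => ->.
  apply/admissibleP; split.
  - by move: HS; rewrite subUset => /andP[].
  - by rewrite -HeH core_setD1.
  - move=> x /setDP[xH xC]; rewrite !inE negb_or HA ?inE ?xC ?xH ?orbT//=.
    apply: contra (inH _ xH) => cx; rewrite -in_set1 -ex !inE xC xH cx.
    by rewrite orbT.
  - move=> u; rewrite !inE negb_or => /andP[/HE[x]].
    rewrite !inE => /andP[/andP[xC /orP[/eqP ->|xH]] cx].
      by rewrite symC cx.
    by move=> _; exists x; rewrite !inE xC xH cx.
case/admissibleP => HS HC HA HE.
have eNH : e \notin H.
  apply/negP => eH; have := HA e.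
  by rewrite !inE eNC eH connect0 orbT => /(_ isT).
rewrite setU1K// eqxx andbT; apply/andP; split.
  apply/admissibleP; split.
  - by rewrite subUset sub1set eS.
  - apply: core_setU1 => // x /HA; rewrite !inE negb_or.
    by case/andP.
  - move=> x; rewrite !inE => /andP[xC /orP[/eqP ->//|xH]].
    by have := HA x; rewrite !inE xC xH negb_or => /(_ isT)/andP[].
  - move=> u uA; have [ue|ue] := boolP (connect (arc C) u (src e)).
      by exists e; rewrite !inE eNC eqxx.
    have [|x] := HE u; first by rewrite !inE negb_or uA symC.
    rewrite !inE => /andP[/andP[xC xH] cx]; exists x.
    by rewrite !inE xC xH cx orbT.
apply/eqP/setP => x; rewrite !inE.
have [->|xe] /= := eqVneq x e; first by rewrite eNC connect0.
apply/negP => /andP[/andP[xC xH] cx].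
by have := HA x; rewrite !inE xC xH cx orbT => /(_ isT).
Qed.

Lemma sign_setU1 H : e \notin H ->
  (-1) ^+ #|(e |: H) :\: C| = - (-1) ^+ #|H :\: C| :> int.
Proof.
move=> eNH; rewrite (_ : (e |: H) :\: C = e |: (H :\: C)).
  by rewrite cardsU1 inE (negPf eNH) andbF exprS mulN1r.
by rewrite setDUl; congr (_ :|: _); apply/setDidPl; rewrite disjoints1.
Qed.

(* Toggling [e] cancels all [H] except those in which [e] is the only edge
   leaving its strong component. *)
Lemma sum_admissible_step :
  \sum_(H | admissible C S A H) (-1) ^+ #|H :\: C| =
  - \sum_(H | admissible C S (A :|: cell C (src e)) H) (-1) ^+ #|H :\: C| :> int.
Proof.
rewrite (bigID (fun H => exits C H (src e) == [set e])) /=.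
rewrite [X in _ + X](_ : _ = 0) ?addr0.
  rewrite (reindex_onto (fun H => e |: H) (fun H => H :\ e)) /=; last first.
    move=> H /andP[_ /eqP eH]; apply: setD1K.
    by have := set11 e; rewrite -eH !inE => /andP[/andP[]].
  rewrite -sumrN; apply: eq_big => [H|H Hadm]; first exact: admissible_merge.
  have eNH : e \notin H by move/andP: Hadm => [_ /eqP <-]; rewrite !inE eqxx.
  by rewrite sign_setU1.
pose toggle H := if e \in H then H :\ e else e |: H.
have toggleK : involutive toggle.
  move=> H; rewrite /toggle; case: (boolP (e \in H)) => eH.
    by rewrite setD11 setD1K.
  by rewrite setU11 setU1K.
have toggle_adm H : admissible C S A H && (exits C H (src e) != [set e]) ->
    admissible C S A (toggle H) && (exits C (toggle H) (src e) != [set e]).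
  case/andP=> Hadm He; rewrite /toggle; case: ifPn => eH.
    rewrite admissible_remove//=; apply/eqP => /setP/(_ e).
    by rewrite !inE eqxx /= andbF.
  rewrite admissible_add//=; case/admissibleP: Hadm => _ _ _ /(_ _ se)[x].
  rewrite !inE => /andP[/andP[xC xH] cx]; apply/eqP => /setP/(_ x).
  rewrite !inE xC xH cx orbT /= => /esym/eqP xe.
  by rewrite -xe xH in eH.
have toggle_sign H : (-1) ^+ #|toggle H :\: C| = - (-1) ^+ #|H :\: C| :> int.
  rewrite /toggle; case: ifPn => eH; last exact: sign_setU1.
  by rewrite -{2}(setD1K eH) sign_setU1 ?opprK// setD11.
set s := \sum_(H | _) _.
have sE : s = - s.
  rewrite {1}/s (reindex_inj (inv_inj toggleK)) /= -sumrN.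
  apply: eq_big => H; last by rewrite toggle_sign.
  by apply/idP/idP => /toggle_adm; rewrite ?toggleK.
lia.
Qed.
End Toggle.

(** * Signed count of rooted acyclic subgraphs *)

Section Sweep.
Variables (C : {set edge r}) (v : 'I_k).
Hypothesis tC : totally_cyclic C.

(** Induction on the complement of [A]: each step absorbs one component of [C] at the cost of a
    sign, until only [H = C] is left. *)
Lemma sum_admissible S A : C \subset S -> rooted v S -> v \in A ->
  (forall u w, connect (arc C) u w -> (u \in A) = (w \in A)) ->
  \sum_(H | admissible C S A H) (-1) ^+ #|H :\: C| =
  (-1) ^+ #|[set u in ~: A | roots (arc C) u]| :> int.
Proof.
move=> CS vS; have [n] := ubnP #|~: A|; elim: n => // n IHn in A *.
rewrite ltnS => An vA clA.
have [A0|/set0Pn[u uA]] := eqVneq (~: A) set0.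
  rewrite A0 (_ : [set u in _ | _] = set0) ?cards0; last first.
    by apply/setP => u; rewrite !inE.
  have AT u : u \in A by have := in_set0 u; rewrite -A0 inE => /negbFE.
  rewrite (big_pred1 C) ?setDv ?cards0// => H.
  apply/admissibleP/eqP => [[HS HC HA _]|->]; last first.
    split=> //; first exact/eqP.
      by move=> x; rewrite setDv inE.
    by move=> u; rewrite AT.
  apply/eqP; rewrite eqEsubset -{2}HC core_sub andbT -setD_eq0.
  apply/eqP/setP => x; rewrite [RHS]inE; apply/negP => /HA.
  by rewrite AT.
(* A path of [S] from [u] to [v] must enter [A]; the entering edge is the one to toggle. *)
have [||e eS /andP[se]] :=
    @connect_arc_crossing S [pred w | w \notin A] _ _ (forallP vS u).
- by rewrite /= -in_setC.
- by rewrite /= vA.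
rewrite /= negbK => te.
rewrite (sum_admissible_step tC clA eS se te) IHn.
- rewrite [in RHS](_ : [set u in _ | _] =
    fingraph.root (arc C) (src e) |:
      [set u in ~: (A :|: cell C (src e)) | roots (arc C) u]).
    rewrite cardsU1 !inE connect_root orbT /= add1n exprS mulN1r//.
  apply/setP => w; rewrite !inE.
  have [wE|wNE] := eqVneq w (fingraph.root (arc C) (src e)).
    rewrite wE roots_root ?andbT; last exact: totally_cyclic_sym.
    by rewrite -(clA (src e)) ?connect_root// se.
  have [wr|] := boolP (roots (arc C) w); last by rewrite !andbF.
  rewrite !andbT /= negb_or; case: (w \in A) => //=.
  apply/esym/negP => sw; move/eqP: wNE; apply; rewrite -(eqP wr).
  by apply/esym/(fingraph.rootP (totally_cyclic_sym tC)).
- apply: leq_trans An; apply: proper_card; rewrite properE.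
  rewrite setCS subsetUl; apply/subsetPn; exists (src e); first by rewrite inE.
  by rewrite !inE connect0 orbT.
- by rewrite inE vA.
move=> u1 u2 cu; rewrite !inE (clA _ _ cu); congr (_ || _).
by apply: same_connect_r; rewrite ?cu//; apply: totally_cyclic_sym.
Qed.

(** Following exits leads to the component of [v]: an exit is not cyclic, so the set of reachable
    vertices strictly shrinks. Conversely, in a rooted [H] an edge outside [C] starting in the
    component of [v] would lie on a cycle, and paths to [v] supply the exits elsewhere. *)
Lemma admissible_rooted S H :
  admissible C S (cell C v) H = [&& H \subset S, core H == C & rooted v H].
Proof.
have symC := totally_cyclic_sym tC.
apply/admissibleP/and3P => [[HS HC HA HE]|[HS /eqP HC vH]].
  split=> //; first exact/eqP.
  apply/forallP => u; have [n] := ubnP #|[set w | connect (arc H) u w]|.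
  elim: n => // n IHn in u *; rewrite ltnS => un.
  have CH : C \subset H by rewrite -HC core_sub.
  have [uv|uv] := boolP (u \in cell C v).
    by apply: (connect_arcS CH); rewrite symC; move: uv; rewrite inE.
  have [x] := HE _ uv; rewrite !inE => /andP[/andP[xC xH] cx].
  have cux : connect (arc H) u (tgt x).
    by apply: connect_trans (connect_arcS CH cx) (connect_edge xH).
  apply: (connect_trans cux); apply: IHn; apply: leq_trans un.
  apply: proper_card; apply/properP; split.
    by apply/subsetP => w; rewrite !inE; apply: (connect_trans cux).
  exists u; rewrite inE ?connect0//; apply: contra xC => cxu.
  by rewrite -HC in_core xH (connect_trans cxu)// (connect_arcS CH cx).
have CH : C \subset H by rewrite -HC core_sub.
split=> // [x /setDP[xH xC]|u]; rewrite inE.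
  apply: contra xC => vx; rewrite -HC in_core xH.
  exact: connect_trans (forallP vH _) (connect_arcS CH vx).
move=> uv; have [||e eH /andP[/= ue te]] :=
  @connect_arc_crossing H (connect (arc C) u) _ _ (forallP vH u).
- exact: connect0.
- by rewrite symC.
exists e; rewrite !inE eH ue !andbT.
by apply: contra te => /connect_edge; apply: connect_trans.
Qed.

(* This is the domination theorem of Satyanarayana and Prabhakar for rooted
   reliability, relative to [C]. *)
Lemma sum_sign_rooted S : C \subset S ->
  \sum_(H : {set edge r} | [&& H \subset S, core H == C & rooted v H])
    (-1) ^+ #|H :\: C| =
  (-1) ^+ (ncomp C).-1 *+ rooted v S :> int.
Proof.
move=> CS; have symC := totally_cyclic_sym tC.
have [vS|vS] := boolP (rooted v S); last first.
  rewrite big_pred0// => H; apply: contraNF vS => /and3P[HS _].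
  exact: rootedS.
rewrite -(eq_bigl _ _ (admissible_rooted S)) sum_admissible//; last 2 first.
- by rewrite inE connect0.
- by move=> u w uw; rewrite !inE; apply: same_connect_r.
rewrite /ncomp (cardsD1 (fingraph.root (arc C) v)) inE roots_root// mulr1n.
congr (_ ^+ _); apply: eq_card => u; rewrite !inE /=.
have [ur|] := boolP (roots (arc C) u); rewrite ?andbF ?andbT//.
by rewrite -root_connect// (eqP ur) eq_sym.
Qed.

Lemma ncomp_gt0 : (0 < ncomp C)%N.
Proof.
by apply/card_gt0P; exists (fingraph.root (arc C) v); rewrite inE roots_root//;
  apply: totally_cyclic_sym.
Qed.
End Sweep.

(** Every component of [C] either meets [W] or is left by an edge of [S] outside [C]; it is charged
    to that vertex or edge. *)
Lemma leq_ncomp_add C S (W : {set 'I_k}) : totally_cyclic C -> C \subset S ->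
  (forall u, exists2 w, w \in W & connect (arc S) u w) ->
  (ncomp C <= #|S :\: C| + #|W|)%N.
Proof.
move=> tC CS SW; have symC := totally_cyclic_sym tC.
apply: leq_trans (_ : #|[set fingraph.root (arc C) (src e) | e in S :\: C] :|:
    [set fingraph.root (arc C) w | w in W]| <= _)%N; last first.
  by rewrite cardsU (leq_trans (leq_subr _ _))// leq_add// leq_imset_card.
apply/subset_leq_card/subsetP => u; rewrite !inE => ur.
have [w wW uw] := SW u; have [uCw|uCw] := boolP (connect (arc C) u w).
  apply/orP; right; apply/imsetP; exists w => //.
  by rewrite -[LHS](eqP ur); apply/(fingraph.rootP symC).
have [//|//|e eS /andP[/= ue te]] :=
  connect_arc_crossing (P := connect (arc C) u) uw.
apply/orP; left; apply/imsetP; exists e; last first.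
  by rewrite -[LHS](eqP ur); apply/(fingraph.rootP symC).
rewrite inE eS andbT; apply: contra te => /connect_edge.
exact: connect_trans.
Qed.

(** This makes the truncated exponents [#|S :\: C|.+1 - ncomp C] genuine differences. *)
Lemma leq_ncomp v C S :
  totally_cyclic C -> C \subset S -> rooted v S -> (ncomp C <= #|S :\: C|.+1)%N.
Proof.
move=> tC CS /forallP vS; rewrite -addn1 -(cards1 v).
by apply: leq_ncomp_add => // u; exists v; rewrite ?set11.
Qed.

Lemma ncomp_leq C C' : totally_cyclic C -> totally_cyclic C' -> C \subset C' ->
  (ncomp C <= #|C' :\: C| + ncomp C')%N.
Proof.
move=> tC tC' CC'; apply: leq_ncomp_add => // u.
exists (fingraph.root (arc C') u); last exact: connect_root.
by rewrite inE roots_root//; apply: totally_cyclic_sym.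
Qed.
End Core.

(** * Sums over subsets and extraction of the g-polynomial *)

Lemma sum_exp_card_subset (R : comNzRingType) (T : finType) (D : {set T})
    (y : R) :
  \sum_(B : {set T} | B \subset D) y ^+ #|B| = (y + 1) ^+ #|D|.
Proof.
rewrite exprD1n (partition_big
  (fun B : {set T} => inord #|B| : 'I_(#|D|.+1)) xpredT)//=.
apply: eq_bigr => i _; rewrite -cards_draws -sumr_const.
apply: eq_big => [B|B /andP[BD /eqP <-]].
  rewrite inE; case: (boolP (B \subset D)) => //= BD.
  by rewrite -val_eqE /= inordK// ltnS subset_leq_card.
by rewrite inordK// ltnS subset_leq_card.
Qed.

Lemma sum_exp_card_superset (R : comNzRingType) (T : finType) (C H : {set T})
    (y : R) : C \subset H ->
  \sum_(S : {set T} | H \subset S) y ^+ #|S :\: C| =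
  y ^+ #|H :\: C| * (y + 1) ^+ #|~: H|.
Proof.
move=> CH; rewrite -sum_exp_card_subset big_distrr /=.
rewrite (reindex_onto (fun B => H :|: B) (fun S => S :\: H)) /=; last first.
  by move=> S HS; rewrite setDE setUIr setUCr setIT; apply/setUidPr.
apply: eq_big => [B|B /andP[_ /eqP BE]].
  rewrite subsetUl /= setDUl setDv set0U -disjoints_subset.
  by apply/eqP/idP => /setDidPl.
have dBH : [disjoint B & H] by rewrite -BE disjoints_subset subsetDr.
rewrite -exprD -cardsUI; congr (_ ^+ _).
rewrite (_ : _ :&: B = set0) ?cards0 ?addn0.
  rewrite setDUl; congr #|pred_of_set (_ :|: _)|; apply/setDidPl.
  exact: disjointWr CH dBH.
by apply/eqP; rewrite setI_eq0 disjoint_sym (disjointWr (subsetDl H C)).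
Qed.

Lemma card_setD (T : finType) (A B D : {set T}) :
  A \subset B -> B \subset D -> #|D :\: A| = (#|D :\: B| + #|B :\: A|)%N.
Proof.
move=> AB BD; rewrite !cardsD !(setIidPr _) ?(subset_trans AB)//.
by have := subset_leq_card AB; have := subset_leq_card BD; lia.
Qed.

(** Multiplication by ['X - 1] takes differences of consecutive coefficients of [h]; up to degree
    [D./2] these are, up to sign, the coefficients of [g_of_h], and [P] does not interfere there. *)
Lemma g_of_h_eq D (h G P : {poly int}) :
  ('X - 1) * h = P - G -> (size G <= D./2.+1)%N ->
  (forall i, (i <= D./2)%N -> P`_i = 0) -> g_of_h D h = G.
Proof.
move=> hE sG P0; apply/polyP => i; rewrite coef_poly ltnS.
have [iD|iD] := leqP i D./2; last by rewrite nth_default// (leq_trans sG).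
have := congr1 (coefp i) hE; rewrite /= coefB (P0 _ iD) mulrBl mul1r coefB.
rewrite coefXM.
by case: i iD => [|i] iD /=; rewrite !sub0r -1?opprB => /oppr_inj.
Qed.

(** * Generating functions of rooted acyclic contractions *)

Section GCore.
Variables (k : nat) (r : 'I_k -> 'I_k -> nat) (v : 'I_k).
Implicit Types (C G H S : {set edge r}) (A : {set 'I_k}) (e x : edge r).
Implicit Types (u w : 'I_k).
Hypothesis rsym : forall i j : 'I_k, i != j -> r i j = r j i.
Hypothesis rpos : forall i j : 'I_k, i != j -> (0 < r i j)%N.

(* This will be the g-polynomial of the face with complement [C], and
   [corank C] its dimension plus one. *)
Definition gcore C : {poly int} :=
  \sum_(S : {set edge r} | (core S == C) && rooted v S)
    ('X - 1) ^+ (#|S :\: C|.+1 - ncomp C).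

Definition corank C := (#|~: C|.+1 - ncomp C)%N.

Lemma edge_rev_subproof (ij : 'I_k * 'I_k) :
  (if ij.1 == ij.2 then 0 else r ij.1 ij.2)%N =
  (if ij.2 == ij.1 then 0 else r ij.2 ij.1)%N.
Proof. by rewrite eq_sym; case: eqVneq => // /rsym. Qed.

Definition edge_rev e : edge r :=
  existT _ ((tag e).2, (tag e).1)
    (cast_ord (edge_rev_subproof (tag e)) (tagged e)).

Lemma edge_revK : involutive edge_rev.
Proof.
case=> [[i j] l]; rewrite /edge_rev /=; congr existT.
exact: val_inj.
Qed.

Lemma totally_cyclicT : totally_cyclic [set: edge r].
Proof.
rewrite /totally_cyclic -subTset; apply/subsetP => e _; rewrite in_core inE /=.
exact: (connect_edge (in_setT (edge_rev e))).
Qed.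

Lemma connectT u w : connect (arc [set: edge r]) u w.
Proof.
have [->//|uw] := eqVneq u w.
have lt0 : (0 < if (u, w).1 == (u, w).2 then 0 else r (u, w).1 (u, w).2)%N.
  by rewrite /= (negPf uw) rpos.
exact: (@connect_edge _ _ _ (existT _ (u, w) (Ordinal lt0) : edge r)).
Qed.

Lemma rootedT : rooted v [set: edge r].
Proof. by apply/forallP => u; apply: connectT. Qed.

(** If [S] contains [e] and its reverse, then [e] lies on a 2-cycle; so reversal injects the
    non-cyclic edges into the complement of [S]. *)
Lemma card_diff_core_leq S : (#|S :\: core S| <= #|~: S|)%N.
Proof.
rewrite -(card_imset _ (inv_inj edge_revK)); apply/subset_leq_card/subsetP.
move=> _ /imsetP[e /setDP[eS eC] ->]; rewrite inE; apply: contra eC => reS.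
by rewrite in_core eS; apply: (connect_edge reS).
Qed.

(** This bounds both the degree of [gcore] and the lowest degree of its reversal. With at least two
    components it follows from reversing edges; with one, every edge of [S] is cyclic. *)
Lemma card_diff_core S :
  core S != setT -> (#|S :\: core S|.*2.+1 < #|~: core S| + ncomp (core S))%N.
Proof.
have tC := core_totally_cyclic S; have sC := core_sub S.
set C := core S in tC sC *; have symC := totally_cyclic_sym tC => CT.
have le1 : (#|S :\: C| <= #|~: S|)%N := card_diff_core_leq S.
have CE : #|~: C| = (#|~: S| + #|S :\: C|)%N.
  rewrite -cardsUI (_ : _ :&: _ = set0) ?cards0 ?addn0; last first.
    by apply/setP => x; rewrite !inE; case: (x \in S); rewrite ?andbF.
  congr #|pred_of_set _|; apply/setP => x.
  rewrite in_setU in_setD !in_setC.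
  by have := subsetP sC x; case: (x \in C) => [-> //|_]; case: (x \in S).
have C0 : (0 < #|~: C|)%N.
  by rewrite card_gt0 -subset0 -setCT setCS subTset.
have := ncomp_gt0 v tC; case n1 : (ncomp C) => [|[|n]] // _; last by lia.
rewrite (_ : S :\: C = set0) ?cards0; first by lia.
apply/eqP; rewrite setD_eq0; apply/subsetP => e eS.
rewrite in_core eS; apply: (connect_arcS sC).
move/eqP/cards1P: n1 => [u uE].
have rE w : connect (arc C) w u.
  have : fingraph.root (arc C) w \in [set u | roots (arc C) u].
    by rewrite inE roots_root.
  by rewrite uE inE => /eqP <-; apply: connect_root.
by apply: connect_trans (rE _) _; rewrite symC.
Qed.

Lemma size_Xsub1_exp n : size (('X - 1) ^+ n : {poly int}) = n.+1.
Proof. by rewrite -[1]/(1%:P) size_exp_XsubC. Qed.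

(** Rooted [S] are grouped by their core; the exponents add up because [corank C - corank C'] equals
    [#|C' :\: C| + ncomp C' - ncomp C]. *)
Lemma gcore_flag C : totally_cyclic C ->
  \sum_(C' : {set edge r} | totally_cyclic C' && (C \subset C'))
     gcore C' * ('X - 1) ^+ (corank C - corank C') =
  \sum_(S : {set edge r} | (C \subset S) && rooted v S)
     ('X - 1) ^+ (#|S :\: C|.+1 - ncomp C).
Proof.
move=> tC.
rewrite [RHS](partition_big (@core _ r)
  (fun C' => totally_cyclic C' && (C \subset C'))) /=; last first.
  by move=> S /andP[CS _]; rewrite core_totally_cyclic subset_core.
apply: eq_bigr => C' /andP[tC' CC']; rewrite /gcore mulr_suml.
apply: eq_big => [S|S /andP[/eqP SC' vS]].
  have [SC'|] := eqVneq (core S) C'; last by rewrite !andbF.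
  by rewrite andbT -(subset_core S tC) SC' CC'.
rewrite -exprD; congr (_ ^+ _).
have C'S : C' \subset S by rewrite -SC' core_sub.
have h1 := leq_ncomp tC' C'S vS; have h2 := ncomp_leq tC tC' CC'.
have := leq_ncomp tC' (subsetT C') rootedT; rewrite setTD => h3.
have h4 : #|S :\: C| = (#|S :\: C'| + #|C' :\: C|)%N := card_setD CC' C'S.
have h5 : #|~: C| = (#|~: C'| + #|C' :\: C|)%N.
  by rewrite -!setTD; apply: card_setD.
by rewrite /corank h4 h5; lia.
Qed.

(** The right-hand side is [gcore C] at 1/t times t to the power [corank C], cleared of
    denominators: the two exponents in each term add up to [corank C]. *)
Lemma gcore_reciprocity C : totally_cyclic C ->
  \sum_(S : {set edge r} | (C \subset S) && rooted v S)
     ('X - 1) ^+ (#|S :\: C|.+1 - ncomp C) =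
  \sum_(H : {set edge r} | (core H == C) && rooted v H)
     'X^#|~: H| * (1 - 'X) ^+ (#|H :\: C|.+1 - ncomp C) :> {poly int}.
Proof.
move=> tC; have n0 := ncomp_gt0 v tC.
have X1 : 'X - 1 != 0 :> {poly int} by rewrite -[1]/(1%:P) polyXsubC_eq0.
(* The extra factor turns each exponent on the left into [#|S :\: C|], for which sums over supersets
   are known. *)
apply: (mulfI (expf_neq0 (ncomp C).-1 X1)); rewrite !big_distrr /=.
have expE S : C \subset S -> rooted v S ->
    #|S :\: C| = ((ncomp C).-1 + (#|S :\: C|.+1 - ncomp C))%N.
  by move=> CS vS; have := leq_ncomp tC CS vS; lia.
transitivity (\sum_(S : {set edge r} | C \subset S)
    ('X - 1) ^+ #|S :\: C| *+ rooted v S : {poly int}).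
  rewrite big_mkcondr /=; apply: eq_bigr => S CS.
  by case: ifP => vS; rewrite ?mulr0n// mulr1n -exprD -expE.
(* The sign is its own inverse, so [sum_sign_rooted] expresses the indicator of [rooted v S] as a
   signed sum over [H]. *)
transitivity (\sum_(S : {set edge r} | C \subset S)
   \sum_(H : {set edge r} | [&& H \subset S, core H == C & rooted v H])
    ((-1) ^+ (ncomp C).-1 * (-1) ^+ #|H :\: C| * ('X - 1) ^+ #|S :\: C|
     : {poly int})).
  apply: eq_bigr => S CS; rewrite -mulr_suml -mulr_sumr.
  have := congr1 (fun z : int => z%:~R : {poly int}) (sum_sign_rooted v tC CS).
  rewrite rmorph_sum rmorphMn rmorphXn rmorphN1 /=.
  under eq_bigr do rewrite rmorphXn rmorphN1.
  move=> ->; rewrite mulrnAr -exprD addnn -mul2n exprM sqrrN expr1n expr1n.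
  by rewrite mulrnAl mul1r.
rewrite (exchange_big_dep (fun H => (core H == C) && rooted v H)) /=; last first.
  by move=> S H _ /and3P[_ -> ->].
apply: eq_bigr => H /andP[/eqP HC vH].
have CH : C \subset H by rewrite -HC core_sub.
rewrite -mulr_sumr.
rewrite (eq_bigl (fun S => H \subset S)); last first.
  move=> S; rewrite HC eqxx vH !andbT andbC.
  by case: (boolP (H \subset S)) => //= HS; rewrite (subset_trans CH).
rewrite (sum_exp_card_superset _ CH) subrK.
rewrite [in (-1) ^+ #|_|]expE// [in ('X - 1) ^+ #|_|]expE//.
set p := (_.+1 - _)%N; set q := (ncomp C).-1.
rewrite -[1 - 'X]opprB !exprD [in RHS]exprNn.
have -> : (-1) ^+ q * ((-1) ^+ q * (-1) ^+ p) = (-1) ^+ p :> {poly int}.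
  by rewrite mulrA -exprD addnn -mul2n exprM sqrrN expr1n expr1n mul1r.
move: ((-1) ^+ p) (('X - 1) ^+ q) (('X - 1) ^+ p) ('X ^+ _) => a b c d.
by rewrite [d * _]mulrC -!mulrA mulrCA.
Qed.

(** Flag sum and reciprocity give [('X - 1) * h = P - gcore C] with [P] the reversal;
    [card_diff_core] puts [gcore C] in degrees at most, and [P] in degrees above, half of
    [(corank C).-1]. *)
Lemma g_of_h_gcore C : totally_cyclic C -> C != setT ->
  (forall C', totally_cyclic C' -> C \proper C' -> (corank C' < corank C)%N) ->
  g_of_h (corank C).-1 (\sum_(C' | totally_cyclic C' && (C \proper C'))
     gcore C' * ('X - 1) ^+ (corank C - corank C').-1) = gcore C.
Proof.
move=> tC CT corankC; have bound S : core S = C ->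
    (#|S :\: C|.*2.+1 < #|~: C| + ncomp C)%N /\
    #|~: C| = (#|~: S| + #|S :\: C|)%N.
  move=> SC; split; first by have := card_diff_core (S := S); rewrite SC => ->.
  by rewrite -!setTD; apply: card_setD; rewrite // -SC core_sub.
apply: (g_of_h_eq (P := \sum_(H : {set edge r} | (core H == C) && rooted v H)
     'X^#|~: H| * (1 - 'X) ^+ (#|H :\: C|.+1 - ncomp C))).
- rewrite -gcore_reciprocity// -gcore_flag// [in RHS](bigD1 C) ?tC ?subxx//=.
  rewrite subnn expr0 mulr1 [RHS]addrC addKr mulr_sumr.
  apply: eq_big => [C'|C' /andP[tC' CC']].
    by rewrite properEneq [C == _]eq_sym -andbA [_ && (C' != C)]andbC.
  by rewrite mulrCA -exprS prednK// subn_gt0 corankC.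
- apply: leq_trans (size_sum _ _ _) _; apply/bigmax_leqP => S /andP[/eqP SC vS].
  rewrite size_Xsub1_exp; have [] := bound _ SC.
  by rewrite /corank; lia.
- move=> i iD; rewrite coef_sum big1// => S /andP[/eqP SC vS].
  have CS : C \subset S by rewrite -SC core_sub.
  rewrite coefXnM ifT//; have [] := bound _ SC; move: iD.
  by have := leq_ncomp tC CS vS; rewrite /corank; lia.
Qed.

Lemma ncompT : ncomp [set: edge r] = 1%N.
Proof.
apply/eqP; rewrite eqn_leq (ncomp_gt0 v totally_cyclicT) andbT.
by have := leq_ncomp totally_cyclicT (subxx _) rootedT; rewrite setDv cards0.
Qed.

Lemma gcoreT : gcore [set: edge r] = 1.
Proof.
rewrite /gcore (big_pred1 setT) ?setDv ?cards0 ?ncompT// => S /=.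
apply/andP/eqP => [[/eqP ST _]|->]; last first.
  by rewrite (eqP totally_cyclicT) rootedT.
by apply/eqP; rewrite -subTset -ST core_sub.
Qed.

Lemma gcore0_comp m : #|{: edge r}| = (m + k.-1).*2 ->
  gcore (set0 : {set edge r}) \Po ('X + 1) =
  \sum_(i < m.+1) (num_rooted_acyclic r v (k.-1 + i)%N)%:R *: 'X^i.
Proof.
move=> nE; have k0 : (0 < k)%N by case: (k) v => [[]|].
have t0 : totally_cyclic (set0 : {set edge r}).
  by rewrite /totally_cyclic -subset0 core_sub.
(* Rootedness forces at least [k.-1] edges and acyclicity allows at most half of all edges, so
   [inord] below never takes its default value. *)
have sizeS S : core S = set0 -> rooted v S -> (k.-1 <= #|S| < k.-1 + m.+1)%N.
  move=> S0 vS; have := leq_ncomp t0 (sub0set S) vS; rewrite ncomp_set0 setD0.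
  have := card_diff_core_leq S; rewrite S0 setD0.
  by have := cardsC S; rewrite nE; lia.
rewrite /gcore raddf_sum /= (partition_big
  (fun S : {set edge r} => inord (#|S| - k.-1) : 'I_m.+1) xpredT)//=.
apply: eq_bigr => i _.
rewrite /num_rooted_acyclic -sum1_card natr_sum scaler_suml.
apply: eq_big => [S|S /andP[/andP[/eqP S0 vS] /eqP <-]]; last first.
  have := sizeS _ S0 vS => /andP[s1 s2].
  have s3 : (#|S| - k.-1 < m.+1)%N by lia.
  have s4 : (#|S|.+1 - k = #|S| - k.-1)%N by lia.
  rewrite (inordK s3).
  rewrite setD0 ncomp_set0 scale1r rmorphXn /= rmorphB /= comp_polyX.
  by rewrite comp_polyC addrK; congr (_ ^+ _); lia.
rewrite inE; apply/andP/asboolP => [[/andP[/eqP S0 vS] /eqP iE]|].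
  have := sizeS _ S0 vS => /andP[s1 s2].
  have s3 : (#|S| - k.-1 < m.+1)%N by lia.
  split.
  (* An edge out of [v] would lie on a cycle, since its target reaches [v]; so acyclic rooted graphs
     avoid these edges by themselves. *)
  - apply/subsetP => e eS; rewrite inE; apply/eqP => ev.
    suff : e \in core S by rewrite S0 inE.
    by rewrite in_core eS ev (forallP vS).
  - exact/acyclicP/eqP.
  - exact/rootedP.
  - by rewrite -iE (inordK s3) subnKC.
move=> [_ /acyclicP S0 /rootedP vS Sk]; rewrite S0 vS; split=> //.
by rewrite -val_eqE /= Sk addKn inordK.
Qed.
End GCore.
(** * Nonnegative circulations *)

Section Circulations.
Variables (R : realType) (k : nat) (r : 'I_k -> 'I_k -> nat).
Hypothesis rsym : forall i j : 'I_k, i != j -> r i j = r j i.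
Implicit Types (C : {set edge r}) (e x : edge r) (u w : 'I_k).

Notation alpha := (@alpha R k r).
Notation beta := (@beta R k r).
Notation T := (subvs_of (relations R r)).

Lemma exists_relation (f : edge r -> R) :
  \sum_e f e *: alpha e = 0 -> exists m : T, forall e, vsval m e = f e.
Proof.
move=> f0; pose g : {ffun edge r -> R^o} := [ffun e => f e].
have gR : g \in relations R r.
  rewrite mem_relations; apply/eqP; rewrite -[RHS]f0.
  by apply: eq_bigr => e _; rewrite ffunE.
by exists (vsproj _ g) => e; rewrite vsprojK// ffunE.
Qed.

Lemma relation_sum (m : T) : \sum_e vsval m e *: alpha e = 0.
Proof. by apply/eqP; rewrite -mem_relations subvsP. Qed.

Lemma sum_alpha : \sum_e alpha e = 0.
Proof.
suff : \sum_e alpha e = - \sum_e alpha e.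
  move/eqP; rewrite -addr_eq0 -mulr2n -scaler_nat scaler_eq0 pnatr_eq0.
  by move/eqP.
rewrite {1}(reindex_inj (inv_inj (edge_revK rsym))) /= -sumrN.
by apply: eq_bigr => e _; rewrite /Defs.alpha opprB.
Qed.

(** Every [beta e] takes the value 1 here, which gives the affine hyperplane containing the
    polytope. *)
Lemma ones_relation : exists m : T, forall e, vsval m e = 1.
Proof.
apply: (@exists_relation (fun=> 1)); rewrite -[RHS]sum_alpha.
by apply: eq_bigr => e _; rewrite scale1r.
Qed.

(** Gale duality: the vectors [beta e] satisfy the coordinate equations of a relation, and [l]
    preserves them. *)
Lemma lin_beta_relation (l : 'Hom(gale_space R r, R^o)) :
  exists m : T, forall e, vsval m e = l (beta e).
Proof.
apply: exists_relation; apply/rowP => j; rewrite summxE mxE.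
have : \sum_e alpha e 0 j *: beta e = 0.
  apply/lfunP => m; rewrite sum_lfunE zero_lfunE.
  transitivity ((\sum_e vsval m e *: alpha e) 0 j); last first.
    by rewrite relation_sum !mxE.
  rewrite summxE; apply: eq_bigr => e _.
  by rewrite scale_lfunE betaE [RHS]mxE [LHS]mulrC.
move/(congr1 l); rewrite linear_sum linear0 => l0; rewrite -[RHS]l0.
by apply: eq_bigr => e _; rewrite linearZ mxE /= mulrC.
Qed.

Lemma exists_eval (m : T) :
  exists l : 'Hom(gale_space R r, R^o), forall y, l y = y m.
Proof.
have lin : linear (fun y : gale_space R r => y m).
  by move=> a y z; rewrite add_lfunE scale_lfunE.
pose F := GRing.isLinear.Build R (gale_space R r) R^o _ _ lin.
pose f : {linear gale_space R r -> R^o} :=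
  HB.pack (fun y : gale_space R r => y m) F.
by exists (linfun f) => y; rewrite lfunE.
Qed.

Lemma connect_flow C u w : connect (arc C) u w ->
  exists f : edge r -> R, [/\ forall e, 0 <= f e, forall e, e \notin C -> f e = 0
    & \sum_e f e *: alpha e = delta_mx 0 u - delta_mx 0 w].
Proof.
move: u; apply: connect_arc_ind => [|e eC _ [f [f0 fC fs]]].
  exists (fun=> 0); split=> //; rewrite subrr big1// => e _.
  by rewrite scale0r.
exists (fun x => f x + (x == e)%:R); split=> [x|x xC|].
- by rewrite addr_ge0.
- rewrite fC// add0r; apply/eqP; rewrite pnatr_eq0 eqb0.
  by apply: contraNneq xC => ->.
under eq_bigr do rewrite scalerDl.
rewrite big_split /= fs (bigD1 e)//= eqxx scale1r big1 ?addr0; last first.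
  by move=> x /negPf->; rewrite scale0r.
by rewrite addrC /Defs.alpha addrA subrK.
Qed.

(** A path back from the target of [e] to its source closes up to a circulation through [e]; these
    are summed over [C]. *)
Lemma totally_cyclic_relation C : totally_cyclic C ->
  exists m : T, (forall e, 0 <= vsval m e) /\
                forall e, (0 < vsval m e) = (e \in C).
Proof.
move=> /eqP tC.
have /fin_all_exists[f fP] : forall e, exists f : edge r -> R,
    [/\ forall x, 0 <= f x, forall x, x \notin C -> f x = 0,
        e \in C -> 0 < f e & \sum_x f x *: alpha x = 0].
  move=> e; have [eC|eC] := boolP (e \in C); last first.
    by exists (fun=> 0); split=> //; rewrite big1// => x _; rewrite scale0r.
  have [|f [f0 fC fs]] := @connect_flow C (tgt e) (src e).
    by move: eC; rewrite -{1}tC in_core => /andP[].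
  exists (fun x => f x + (x == e)%:R); split=> [x|x xC|_|].
  - by rewrite addr_ge0.
  - rewrite fC// add0r; apply/eqP; rewrite pnatr_eq0 eqb0.
    by apply: contraNneq xC => ->.
  - by rewrite eqxx ltr_wpDl.
  under eq_bigr do rewrite scalerDl.
  rewrite big_split /= fs (bigD1 e)//= eqxx scale1r big1 ?addr0; last first.
    by move=> x /negPf->; rewrite scale0r.
  by rewrite /Defs.alpha addrA subrK subrr.
have [|m mE] := @exists_relation (fun x => \sum_e f e x).
  under eq_bigr do rewrite scaler_suml.
  by rewrite exchange_big big1// => e _; have [] := fP e.
exists m; split=> e; rewrite mE.
  by apply: sumr_ge0 => x _; have [] := fP x.
have [eC|eC] := boolP (e \in C).
  rewrite (bigD1 e)//= ltr_pwDl//; first by have [_ _ ->] := fP e.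
  by apply: sumr_ge0 => x _; have [] := fP x.
by rewrite big1 ?ltxx// => x _; have [_ fC _ _] := fP x; apply: fC.
Qed.

(** Let [U] be the set of vertices reachable from the target of [e]. Edges of [C] never leave [U]
    and the net flow into [U] is zero, so [e], carrying positive flow, cannot enter [U] from
    outside. *)
Lemma relation_totally_cyclic (m : T) : (forall e, 0 <= vsval m e) ->
  totally_cyclic [set e | 0 < vsval m e]%SET.
Proof.
move=> m0; set C := [set e | _]%SET.
rewrite /totally_cyclic eqEsubset core_sub; apply/subsetP => e eC.
rewrite in_core eC /=; apply: contraT => nc.
pose U := [set w | connect (arc C) (tgt e) w]%SET.
have : \sum_x vsval m x * ((tgt x \in U)%:R - (src x \in U)%:R) = 0 :> R.
  transitivity (- \sum_(u in U) (\sum_x vsval m x *: alpha x) 0 u).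
    under [in RHS]eq_bigr do rewrite summxE.
    rewrite exchange_big -sumrN; apply: eq_bigr => x _ /=.
    under eq_bigr do rewrite mxE; rewrite -mulr_sumr -mulrN; congr (_ * _).
    rewrite (eq_bigr (fun u => (u == src x)%:R - (u == tgt x)%:R)); last first.
      by move=> u _; rewrite !mxE !eqxx.
    have sum1 w : \sum_(u in U) (u == w)%:R = (w \in U)%:R :> R.
      have [wU|wU] := boolP (w \in U).
        by rewrite (bigD1 w)//= eqxx big1 ?addr0// => u /andP[_ /negPf->].
      by rewrite big1// => u uU; case: eqVneq wU => // <-; rewrite uU.
    by rewrite sumrB !sum1 opprB.
  by rewrite relation_sum big1 ?oppr0// => u _; rewrite mxE.
move/eqP; rewrite psumr_eq0; last first.
  move=> x _; have [xC|xC] := boolP (x \in C); last first.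
    have -> : vsval m x = 0.
      by apply/eqP; rewrite eq_le m0 andbT leNgt; move: xC; rewrite inE.
    by rewrite mul0r.
  rewrite mulr_ge0// subr_ge0 ler_nat.
  case: (boolP (src x \in U)) => //; rewrite !inE => sx.
  by rewrite (connect_trans sx (connect_edge xC)).
move=> /allP/(_ e (mem_index_enum _)) /=.
rewrite !inE connect0 (negPf nc) subr0 mulr1 => /eqP me.
by move: eC; rewrite inE me ltxx.
Qed.
End Circulations.

(** * Faces of the root polytope *)

Section Hull.
Variables (R : realType) (k : nat) (r : 'I_k -> 'I_k -> nat).
Hypothesis rsym : forall i j : 'I_k, i != j -> r i j = r j i.
Implicit Types (C : {set edge r}) (e : edge r) (l : 'Hom(gale_space R r, R^o)).

Notation beta := (@beta R k r).
Notation T := (subvs_of (relations R r)).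

Definition hull C : set (gale_space R r) :=
  [set y | exists w : edge r -> R, [/\ forall e, 0 <= w e, \sum_e w e = 1,
     forall e, e \in C -> w e = 0 & y = \sum_e w e *: beta e]]%classic.

Lemma root_polytope_hull : root_polytope R r = hull set0.
Proof.
rewrite seteqP; split=> y [w].
  by case=> w0 w1 ->; exists w; split=> // e; rewrite inE.
by case=> w0 w1 _ ->; exists w; split.
Qed.

Lemma beta_hull C e : e \notin C -> hull C (beta e).
Proof.
move=> eC; exists (fun x => (x == e)%:R); split.
- by move=> x; rewrite ler0n.
- by rewrite (bigD1 e)//= eqxx big1 ?addr0// => x /negPf->.
- by move=> x xC; case: eqP xC eC => // -> ->.
- rewrite (bigD1 e)//= eqxx scale1r big1 ?addr0// => x /negPf->.
  by rewrite scale0r.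
Qed.

Lemma hull_setT : hull setT = classical_sets.set0.
Proof.
rewrite -classical_sets.subset0 => y [w [_ w1 w0 _]].
have := oner_neq0 R; rewrite -w1 big1 ?eqxx// => e _.
by rewrite w0 ?inE.
Qed.

Lemma hull_face C l c : (forall e, e \notin C -> l (beta e) <= c) ->
  [set y | hull C y /\ l y = c]%classic =
  hull (C :|: [set e | l (beta e) != c]).
Proof.
move=> lc; rewrite seteqP.
split=> [y [[w [w0 w1 wC ->]] ly]|y [w [w0 w1 wC ->]]].
  exists w; split=> // e /setUP[/wC//|]; rewrite inE => lec; apply/eqP.
  have : \sum_e w e * (c - l (beta e)) == 0.
    under eq_bigr do rewrite mulrBr.
    rewrite sumrB -mulr_suml w1 mul1r -ly linear_sum subr_eq0; apply/eqP.
    by apply: eq_bigr => j _; rewrite linearZ.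
  rewrite psumr_eq0 => [/allP/(_ e (mem_index_enum _))/=|x _].
    by rewrite mulf_eq0 subr_eq0 [c == _]eq_sym (negPf lec) orbF.
  have [/wC->|/lc xc] := boolP (x \in C); first by rewrite mul0r.
  by rewrite mulr_ge0 ?subr_ge0.
split; first by exists w; split=> // e eC; rewrite wC// inE eC.
rewrite linear_sum -[RHS]mul1r -w1 mulr_suml; apply: eq_bigr => e _.
rewrite linearZ /=; have [->//|lec] := eqVneq (l (beta e)) c.
by rewrite wC ?scale0r ?mul0r// !inE lec orbT.
Qed.

Lemma hull_eval C (m : T) y : hull C y ->
  (forall e, e \notin C -> vsval m e = 0) -> y m = 0.
Proof.
case=> w [_ _ wC ->] m0; rewrite sum_lfunE big1// => e _.
rewrite scale_lfunE betaE; have [/wC->|/m0->] := boolP (e \in C).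
  by rewrite scale0r.
by rewrite scaler0.
Qed.

(** A circulation with support exactly [C'] vanishes on [hull C'] but is positive at [beta e] for
    [e] in [C']. *)
Lemma hull_subset C C' : totally_cyclic C' ->
  (hull C `<=` hull C')%classic -> C' \subset C.
Proof.
move=> tC' CC'; have [z [z0 zP]] := totally_cyclic_relation R tC'.
apply/subsetP => e eC'; apply/negPn/negP => eC.
have /hull_eval : hull C' (beta e) by apply: CC'; apply: beta_hull.
move=> /(_ z) ze; have : 0 < vsval z e by rewrite zP.
rewrite -betaE ze ?ltxx// => x xC'; apply/eqP.
by rewrite eq_le z0 andbT leNgt zP.
Qed.

Lemma hull_inj C C' : totally_cyclic C -> totally_cyclic C' ->
  hull C = hull C' -> C = C'.
Proof.
by move=> tC tC' CC'; apply/eqP; rewrite eqEsubset !hull_subset// CC'.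
Qed.

(* The faces are cut out by nonnegative circulations. Such a circulation is
   only determined up to one supported in [C], so it can be made positive on
   [C]. *)
Lemma is_face_hull C (F : set (gale_space R r)) : totally_cyclic C ->
  is_face (hull C) F <->
  exists C', [/\ totally_cyclic C', C \subset C' & F = hull C'].
Proof.
move=> tC; split=> [[l [c [lc ->]]]|[C' [tC' CC' ->]]].
  have lC e : e \notin C -> l (beta e) <= c by move=> eC; apply/lc/beta_hull.
  rewrite (hull_face lC); set C' := _ :|: _; exists C'; split=> //; last first.
    exact: subsetUl.
  have [m mE] := lin_beta_relation l; have [one oneE] := ones_relation R rsym.
  have [z [z0 zP]] := totally_cyclic_relation R tC.
  (* Each summand of [M] suffices for its own edge: on [C], [M * vsval z x] exceeds the absolute
     value of [c - l (beta x)]. *)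
  pose M := \sum_(x in C) (`|c - l (beta x)| + 1) / vsval z x.
  have fE e : vsval (c *: one - m + M *: z) e = c - l (beta e) + M * vsval z e.
    by rewrite !linearE /= !ffunE oneE mE /GRing.scale /= mulr1.
  have z0C e : e \notin C -> vsval z e = 0.
    by move=> eC; apply/eqP; rewrite eq_le z0 andbT leNgt zP.
  have fC e : e \in C -> 0 < c - l (beta e) + M * vsval z e.
    move=> eC; have ze : 0 < vsval z e by rewrite zP.
    have : `|c - l (beta e)| + 1 <= M * vsval z e.
      rewrite -ler_pdivrMr// /M (bigD1 e)//= lerDl.
      apply: sumr_ge0 => x /andP[xC _].
      by rewrite divr_ge0// addr_ge0.
    by have := ler_norm (- (c - l (beta e))); rewrite normrN; lra.
  have fNC e : e \notin C -> c - l (beta e) + M * vsval z e = c - l (beta e).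
    by move=> /z0C ->; rewrite mulr0 addr0.
  have -> : C' = [set e | 0 < vsval (c *: one - m + M *: z) e].
    apply/setP => e; rewrite !inE fE; have [eC|eC] := boolP (e \in C).
      by rewrite fC.
    by rewrite fNC//= subr_gt0 lt_neqAle lC// andbT.
  apply: relation_totally_cyclic => e; rewrite fE.
  have [/fC/ltW//|eC] := boolP (e \in C).
  by rewrite fNC// subr_ge0 lC.
have [z [z0 zP]] := totally_cyclic_relation R tC'.
(* Evaluation at [- z] is at most 0 on the polytope and vanishes at [beta e] exactly for [e] outside
   [C']. *)
have [l lE] := exists_eval (- z).
have lb e : l (beta e) = - vsval z e by rewrite lE betaE linearN ffunE.
have lC e : e \notin C -> l (beta e) <= 0 by rewrite lb oppr_le0.
exists l, 0; split.
  move=> y [w [w0 _ wC ->]]; rewrite linear_sum; apply: sumr_le0 => e _.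
  by rewrite linearZ /= lb scalerN oppr_le0; apply: mulr_ge0.
rewrite (hull_face lC); congr hull; apply/setP => e.
rewrite !inE lb oppr_eq0 neq_lt ltNge z0 /= zP; apply/idP/orP => [->|].
  by right.
by case=> // /(subsetP CC').
Qed.

Lemma proper_faces_hull C : totally_cyclic C ->
  proper_faces (hull C) =
  (hull @` [set` [pred C' | totally_cyclic C' && (C \proper C')]])%classic.
Proof.
move=> tC; rewrite seteqP.
split=> [F [/(is_face_hull _ tC)[C' [tC' CC' FE]] FN]|].
  exists C' => //=; rewrite inE tC' properEneq CC' andbT.
  by apply: contra_not_neq FN => ->.
move=> F [C' /=]; rewrite inE => /andP[tC' CC'] <-{F}; split.
  by apply/is_face_hull => //; exists C'; split=> //; apply: proper_sub.
by move/(hull_inj tC' tC) => CE; rewrite CE properxx in CC'.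
Qed.
End Hull.

(** * Dimension of the faces *)

Section Spans.
Variables (R : realType) (V : vectType R).

Lemma dim_span_image (I : finType) (A : {set I}) (f : I -> V) :
  (forall c : I -> R,
     \sum_(i in A) c i *: f i = 0 -> {in A, forall i, c i = 0}) ->
  \dim <<[seq f i | i in A]>> = #|A|.
Proof.
move=> fA; suff /eqP -> : free (image_tuple f [in A]) by rewrite size_tuple.
apply/freeP => c c0 i; have iA := enum_valP i.
rewrite -[i](enum_valK_in iA).
apply: (fA (fun x => c (enum_rank_in iA x)) _ _ iA).
rewrite -[RHS]c0 big_enum_val.
by apply: eq_bigr => j _; rewrite enum_valK_in nth_image.
Qed.

(* If the joint image [L] of a basis of [B] were a proper subspace of the row
   space, then a nonzero functional vanishing on [L] would give a linear
   relation in the basis. *)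
Lemma dim_annihilator (B : {vspace 'Hom(V, R^o)}) :
  exists2 K : {vspace V}, forall m, m \in K <-> forall y, y \in B -> y m = 0
    & (\dim K + \dim B = \dim {:V})%N.
Proof.
pose b := vbasis B.
pose psi_fun (m : V) : 'rV[R]_(\dim B) := \row_i (b`_i m).
have psi_lin : linear psi_fun.
  by move=> a m m'; apply/rowP => i; rewrite !mxE linearP.
pose F := GRing.isLinear.Build R V 'rV[R]_(\dim B) _ _ psi_lin.
pose psi_l : {linear V -> 'rV[R]_(\dim B)} := HB.pack psi_fun F.
pose psi := linfun psi_l.
have psiE m i : psi m 0 i = b`_i m by rewrite lfunE /= mxE.
exists (lker psi) => [m|].
  rewrite memv_ker; split=> [/eqP pm0 y yB|m0].
    rewrite (coord_vbasis yB) sum_lfunE big1// => i _.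
    by rewrite scale_lfunE -psiE pm0 mxE scaler0.
  apply/eqP/rowP => i; rewrite psiE mxE; apply: m0.
  by apply: vbasis_mem; rewrite mem_nth ?size_tuple.
rewrite -[RHS](limg_ker_dim psi) capfv; congr (_ + _)%N.
suff -> : limg psi = fullv; first by rewrite dimvf dim_matrix mul1r.
apply/eqP; rewrite eqEsubv subvf /=; apply/subvP => u _.
set L := limg psi; apply: contraT => uL.
have : u - projv L u != 0.
  apply: contraNneq uL => /eqP; rewrite subr_eq0 => /eqP ->.
  exact: memv_proj.
move/rV0Pn => [j uj].
(* This functional vanishes on [L] but not at [u]. *)
pose phi (x : 'rV[R]_(\dim B)) : R := (x - projv L x) 0 j.
have phiE x : phi x = \sum_i x 0 i * phi (delta_mx 0 i).
  rewrite {1}[x]row_sum_delta /phi linear_sum -sumrB summxE.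
  by apply: eq_bigr => i _; rewrite linearZ -scalerBr mxE.
have phi0 i : phi (delta_mx 0 i) = 0.
  have /freeP/(_ (fun i => phi (delta_mx 0 i))) := basis_free (vbasisP B).
  apply.
  apply/lfunP => m; rewrite sum_lfunE zero_lfunE.
  transitivity (phi (psi m)).
    rewrite phiE; apply: eq_bigr => i' _.
    by rewrite scale_lfunE psiE mulrC.
  by rewrite /phi projv_id ?memv_img ?memvf// subrr mxE.
move: uj; rewrite -/(phi u) phiE big1 ?eqxx// => i _.
by rewrite phi0 mulr0.
Qed.
End Spans.

(** * Dimensions of circulation spaces and hulls *)

Section Dimension.
Variables (R : realType) (k : nat) (r : 'I_k -> 'I_k -> nat).
Hypothesis rsym : forall i j : 'I_k, i != j -> r i j = r j i.
Hypothesis rpos : forall i j : 'I_k, i != j -> (0 < r i j)%N.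
Implicit Types (C : {set edge r}) (e : edge r).

Notation alpha := (@alpha R k r).
Notation beta := (@beta R k r).
Notation T := (subvs_of (relations R r)).
Notation E := {ffun edge r -> R^o}.

(** Paths inside the components of [C] show that the [alpha e] span the differences [gen u] between
    a vertex and its representative; those with [u] not a representative are independent. *)
Lemma dim_span_alpha C : totally_cyclic C ->
  (\dim <<[seq alpha e | e in C]>> + ncomp C = k)%N.
Proof.
move=> tC; have symC := totally_cyclic_sym tC.
pose rt := fingraph.root (arc C).
pose gen u : 'rV[R]_k := delta_mx 0 u - delta_mx 0 (rt u).
pose N := [set u | ~~ roots (arc C) u].
have -> : <<[seq alpha e | e in C]>>%VS = <<[seq gen u | u in N]>>%VS.
  have genI u : gen u \in <<[seq gen u | u in N]>>%VS.
    have [uN|] := boolP (u \in N); first by apply/memv_span/image_f.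
    by rewrite inE negbK => /eqP ru; rewrite /gen /rt ru subrr mem0v.
  apply/eqP; rewrite eqEsubv; apply/andP; split; apply/span_subvP => y.
    move=> /imageP[e eC ->].
    rewrite (_ : alpha e = gen (src e) - gen (tgt e)); first exact: rpredB.
    have -> : gen (tgt e) = delta_mx 0 (tgt e) - delta_mx 0 (rt (src e)).
      rewrite /gen /rt; congr (_ - delta_mx 0 _); apply/(fingraph.rootP symC).
      by rewrite symC connect_edge.
    by rewrite /Defs.alpha /gen opprB addrA subrK.
  move=> /imageP[u _ ->].
  have [//|f [_ fC fs]] := @connect_flow R k r C u (rt u).
    exact: connect_root.
  rewrite /gen -fs (bigID [in C]) /= [X in _ + X]big1 ?addr0; last first.
    by move=> e eC; rewrite fC// scale0r.
  by apply: rpred_sum => e eC; apply/rpredZ/memv_span/image_f.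
rewrite dim_span_image.
  rewrite -[RHS](card_ord k) -(cardsC N) /ncomp; congr (_ + _)%N.
  by apply: eq_card => u; rewrite !inE negbK.
(* Coordinate [u] isolates [c u]: as [u] is not a representative, no other generator involves it. *)
move=> c c0 u uN; have := congr1 (fun y : 'rV[R]_k => y 0 u) c0.
rewrite mxE summxE (bigD1 u)//= big1.
  rewrite !mxE !eqxx /= addr0 [u == _]eq_sym.
  have -> : (rt u == u) = false by move: uN; rewrite inE => /negPf.
  by rewrite subr0 mulr1.
move=> w /andP[wN wu]; rewrite !mxE !eqxx /= [u == w]eq_sym (negPf wu).
have -> : (u == rt w) = false.
  by apply: contraTF uN => /eqP ->; rewrite inE negbK roots_root.
by rewrite subrr mulr0.
Qed.

Definition single e : E := [ffun x => (x == e)%:R].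

Lemma sum_single (A : {set edge r}) (c : edge r -> R) x :
  (\sum_(e in A) c e *: single e) x = if x \in A then c x else 0.
Proof.
rewrite sum_ffunE; case: ifPn => xA.
  rewrite (bigD1 x)//= big1 ?addr0 => [|e /andP[_ ex]].
    by rewrite !ffunE eqxx /GRing.scale /= mulr1.
  by rewrite !ffunE eq_sym (negPf ex) scaler0.
rewrite big1// => e eA; rewrite !ffunE; case: eqVneq => [xe|].
  by rewrite xe eA in xA.
by rewrite scaler0.
Qed.

Lemma mem_span_single C (m : E) :
  reflect (forall e, e \notin C -> m e = 0)
    (m \in <<[seq single e | e in C]>>%VS).
Proof.
apply: (iffP idP) => [mC e eC|mC].
  rewrite (coord_span (X := image_tuple single [in C]) mC) sum_ffunE.
  rewrite big1// => i _.
  rewrite !ffunE nth_image ffunE; case: eqVneq => [ei|].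
    by rewrite ei enum_valP in eC.
  by rewrite scaler0.
rewrite (_ : m = \sum_(e in C) m e *: single e).
  by apply: rpred_sum => e eC; apply/rpredZ/memv_span/image_f.
apply/ffunP => x; rewrite sum_single; by case: ifPn => // /mC.
Qed.

Lemma dim_relations_support C : totally_cyclic C ->
  (\dim (<<[seq single e | e in C]>> :&: relations R r) + k =
   #|C| + ncomp C)%N.
Proof.
move=> tC.
have := limg_ker_dim (linfun (@rel_map R k r)) <<[seq single e | e in C]>>.
rewrite limg_span -/(relations R r) -map_comp.
rewrite (_ : [seq _ | e <- enum C] = [seq alpha e | e in C]); last first.
  apply: eq_map => e /=; rewrite lfunE /= /rel_map (bigD1 e)//= ffunE eqxx.
  rewrite scale1r.
  by rewrite big1 ?addr0// => x /negPf xe; rewrite ffunE xe scale0r.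
rewrite [RHS]dim_span_image => [<-|c c0 e eC]; last first.
  by have := congr1 (fun m : E => m e) c0; rewrite sum_single eC ffunE.
by have := dim_span_alpha tC; lia.
Qed.

Lemma dim_relations (v : 'I_k) :
  (\dim (relations R r) + k = #|{: edge r}| + 1)%N.
Proof.
have := dim_relations_support (totally_cyclicT rsym).
rewrite (ncompT v rsym rpos) cardsT (capv_idPr _)//.
by apply/subvP => m _; apply/mem_span_single => e; rewrite inE.
Qed.

(** The annihilator of these [beta e] consists of the circulations supported in [C], whose dimension
    is known from rank-nullity. *)
Lemma dim_span_beta (v : 'I_k) C : totally_cyclic C ->
  \dim <<[seq beta e | e in ~: C]>> = corank C.
Proof.
move=> tC; set B := <<_>>%VS; have [K KP dimK] := dim_annihilator B.
have KE m : m \in K <-> forall e, e \notin C -> vsval m e = 0.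
  rewrite KP; split=> [m0 e eC|m0 y yB].
    by rewrite -betaE; apply: m0; apply/memv_span/image_f; rewrite inE.
  rewrite (coord_span (X := image_tuple beta [in ~: C]) yB) sum_lfunE.
  rewrite big1// => i _.
  rewrite scale_lfunE nth_image betaE m0 ?scaler0//.
  by have := enum_valP i; rewrite inE.
pose f := linfun (vsval : T -> E).
have fE m : f m = vsval m by rewrite lfunE.
have dimfK : \dim (f @: K) = \dim K.
  apply/limg_dim_eq/eqP; rewrite -subv0; apply/subvP => m /memv_capP[_].
  by rewrite memv_ker fE memv0 => /eqP m0; apply/eqP/val_inj;
    apply: etrans m0 _; rewrite linear0.
have fK : (f @: K)%VS = (<<[seq single e | e in C]>> :&: relations R r)%VS.
  apply/vspaceP => m; apply/memv_imgP/memv_capP => [[m' /KE m'K ->]|[mC mR]].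
    by rewrite fE subvsP; split=> //; apply/mem_span_single.
  exists (vsproj _ m); last by rewrite fE vsprojK.
  by apply/KE => e eC; rewrite vsprojK//; move/mem_span_single: mC; apply.
have hC := dim_relations_support tC; rewrite -fK dimfK in hC.
have hT := dim_relations v; have hn := cardsC C.
have hk := leq_ncomp tC (subsetT C) (rootedT v rpos); rewrite setTD in hk.
have dimT : \dim {:T} = \dim (relations R r) by rewrite dimvf.
rewrite dimT in dimK.
suff arith a b c d d' n p : (a + b = c -> c + k = n + 1 -> d + d' = n ->
    p <= d'.+1 -> a + k = d + p -> b = d'.+1 - p)%N.
  exact: arith dimK hT hn hk hC.
by lia.
Qed.

Lemma hull_one C (one : T) (y : gale_space R r) :
  (forall e, vsval one e = 1) -> hull C y -> y one = 1.
Proof.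
move=> oneE [w [_ w1 _ ->]]; rewrite sum_lfunE -[RHS]w1.
by apply: eq_bigr => e _; rewrite scale_lfunE betaE oneE /GRing.scale /= mulr1.
Qed.

Lemma hull_span C (y : gale_space R r) :
  hull C y -> y \in <<[seq beta e | e in ~: C]>>%VS.
Proof.
case=> w [_ _ wC ->]; rewrite (bigID [in C]) /= big1 ?add0r => [|e /wC->].
  by apply: rpred_sum => e eC; apply/rpredZ/memv_span/image_f; rewrite inE.
by rewrite scale0r.
Qed.

(** All points of the hull take the value 1 at [one], so affine and linear independence agree there
    and the count is the dimension of the linear span. *)
Lemma dim1_hull (v : 'I_k) C :
  totally_cyclic C -> dim1 (hull (R := R) C) = corank C.
Proof.
move=> tC; rewrite -(dim_span_beta v tC); set B := <<_>>%VS.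
have [one oneE] := ones_relation R rsym.
have [x [xC xfree]] := dim1_witness (hull (R := R) C).
set m := dim1 _ in x xC xfree *.
pose X := [tuple x i | i < m].
have XE (i : 'I_m) : X`_i = x i by rewrite -tnth_nth tnth_mktuple.
apply/eqP; rewrite eqn_leq; apply/andP; split.
  have /eqP <- : size X == m by rewrite size_tuple.
  suff /eqP <- : free X.
    apply: dimvS; apply/span_subvP => y /tnthP[i ->].
    by rewrite tnth_mktuple; apply: hull_span.
  apply/freeP => c c0; apply: xfree.
    by rewrite -[RHS]c0; apply: eq_bigr => i _; rewrite XE.
  have := congr1 (fun y : gale_space R r => y one) c0.
  rewrite sum_lfunE zero_lfunE => c1; rewrite -[RHS]c1; apply: eq_bigr => i _.
  by rewrite scale_lfunE XE (hull_one oneE (xC i)) /GRing.scale /= mulr1.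
(* A [beta e] outside the span of [X] could be added to [x], exceeding the maximal number [m] of
   affinely independent points. *)
have sBX : (B <= <<X>>)%VS.
  apply/span_subvP => y /imageP[e]; rewrite inE => eC -> {y}.
  apply: contraT => eX.
  pose y (i : 'I_m.+1) := if unlift ord0 i is Some j then x j else beta e.
  suff : (m.+1 <= m)%N by rewrite ltnn.
  apply: (@affine_free_dim1 _ _ (hull C) _ y).
    by move=> i; rewrite /y; case: unliftP => // _; apply: beta_hull.
  move=> c; rewrite !big_ord_recl /y unlift_none => cy0 c0.
  have cy1 : c ord0 *: beta e + \sum_i c (lift ord0 i) *: x i = 0.
    by rewrite -[RHS]cy0; congr (_ + _); apply: eq_bigr => i _; rewrite liftK.
  have c00 : c ord0 = 0.
    apply: contraNeq eX => c0N; rewrite -[beta e](scalerK c0N) rpredZ//.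
    move/eqP: cy1; rewrite addr_eq0 => /eqP ->; rewrite rpredN.
    apply: rpred_sum => i _; apply/rpredZ/memv_span.
    by rewrite -XE mem_nth ?size_tuple.
  move: cy1 c0; rewrite c00 scale0r !add0r => cx c1 i.
  have [j ->|->//] := unliftP ord0 i.
  exact: (xfree (fun j => c (lift ord0 j))).
by apply: leq_trans (dimvS sBX) _; rewrite (leq_trans (dim_span _))// size_tuple.
Qed.

(** Strictness is read off from the geometry: a proper face has smaller dimension. *)
Lemma corank_proper (v : 'I_k) C C' :
  totally_cyclic C -> totally_cyclic C' -> C \proper C' ->
  (corank C' < corank C)%N.
Proof.
move=> tC tC' CC'; rewrite -!(dim1_hull v)//; apply: dim1_proper_face.
rewrite (proper_faces_hull _ rsym tC); exists C' => //=.
by rewrite inE tC'.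
Qed.

(** Induction upwards from the empty face [C = setT]; the face correspondence turns the recursion
    for [gpoly] into [g_of_h_gcore]. *)
Lemma gpoly_hull (v : 'I_k) C :
  totally_cyclic C -> gpoly (hull (R := R) C) = gcore v C.
Proof.
have [n] := ubnP #|~: C|; elim: n => // n IHn in C *; rewrite ltnS => Cn tC.
have [->|CT] := eqVneq C setT; first by rewrite hull_setT gpoly0 gcoreT.
have C0 : hull (R := R) C <> classical_sets.set0.
  have [e eC] : exists e, e \notin C.
    apply/existsP; apply: contraNT CT => /existsPn CT; apply/eqP/setP => e.
    by have := CT e; rewrite negbK inE => ->.
  by move=> C0; have := @beta_hull R _ _ _ _ eC; rewrite C0.
rewrite gpolyE// hpolyE// dim1_hull//.
rewrite -[RHS](g_of_h_gcore _ rsym rpos)//; last first.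
  by move=> C' tC' CC'; apply: (corank_proper v).
congr g_of_h; rewrite proper_faces_hull// fsbig_image; last first.
  move=> C1 C2 /set_mem /andP[t1 _] /set_mem /andP[t2 _].
  exact: hull_inj.
set P := [pred C' | _].
rewrite (_ : [set` P]%classic = [set` enum P]%classic); last first.
  by rewrite seteqP; split=> C' /=; rewrite mem_enum.
rewrite -fsbig_seq ?enum_uniq// big_enum /=.
apply: eq_big => // C' /andP[tC' CC'].
by rewrite IHn ?dim1_hull// (leq_trans _ Cn)// proper_card// properC.
Qed.
End Dimension.

(** * Number of edges and conclusion *)

Lemma card_edge (k : nat) (r : 'I_k -> 'I_k -> nat) :
  (forall i j : 'I_k, i != j -> r i j = r j i) ->
  #|{: edge r}| = (\sum_(i < k) \sum_(j < k | (i < j)%N) r i j).*2.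
Proof.
move=> rsym; rewrite card_tagged sumnE big_map big_enum /=.
under eq_bigr do rewrite card_ord.
rewrite -(pair_bigA _ (fun i j => if i == j then 0 else r i j)%N) /=.
transitivity (\sum_(i < k) (\sum_(j < k | (i < j)%N) r i j +
    \sum_(j < k | (j < i)%N) r j i))%N.
  apply: eq_bigr => i _; rewrite (bigD1 i)//= eqxx add0n.
  rewrite (bigID (fun j : 'I_k => (i < j)%N)) /=; congr (_ + _)%N.
    apply: eq_big => [j|j /andP[ji _]]; last by rewrite eq_sym (negPf ji).
    by rewrite -val_eqE /=; lia.
  apply: eq_big => [j|j /andP[ji _]]; last first.
    by rewrite eq_sym (negPf ji) rsym// eq_sym.
  by rewrite -val_eqE /=; lia.
by rewrite big_split /= [X in (_ + X)%N](exchange_big_dep xpredT)//= addnn.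
Qed.

Theorem theorem4p2 (R : realType) (k : nat) (hk : (2 <= k)%N)
    (r : 'I_k -> 'I_k -> nat)
    (rsym : forall i j : 'I_k, i != j -> r i j = r j i)
    (rpos : forall i j : 'I_k, i != j -> (0 < r i j)%N) :
  let v1 : 'I_k := Ordinal (ltnW hk) in
  let dhat : nat := ((\sum_(i < k) \sum_(j < k | i < j) r i j) - (k - 1))%N in
  gpoly (root_polytope R r) \Po ('X + 1) =
  \sum_(i < dhat.+1) (num_rooted_acyclic r v1 (k - 1 + i)%N)%:R *: 'X^i.
Proof.
move=> v1 dhat; rewrite root_polytope_hull (gpoly_hull R rsym rpos v1); last first.
  by rewrite /totally_cyclic -subset0 core_sub.
rewrite subn1 (gcore0_comp (m := dhat) v1 rsym)// card_edge//.
congr _.*2; rewrite /dhat subn1 subnK//.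
(* The edges from the first vertex to the others already number at least [k - 1], so the truncated
   subtraction in [dhat] is exact. *)
suff le1 : (\sum_(j < k | (v1 < j)%N) 1 <=
    \sum_(i < k) \sum_(j < k | i < j) r i j)%N.
  apply: leq_trans le1; rewrite sum1_card.
  rewrite -[X in (X.-1 <= _)%N](card_ord k) -(cardC1 v1).
  by apply/subset_leq_card/subsetP => j; rewrite !inE -val_eqE /=; lia.
rewrite [leqRHS](bigD1 v1)//=; apply: leq_trans (leq_addr _ _).
by apply: leq_sum => j v1j; rewrite rpos// -val_eqE /= neq_ltn v1j.
Qed.
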